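(* Let $X$ be a Hilbert space and let $\mathcal{H}$ be a locally finite weight in $X$ with corresponding subspaces $(X_n)_{n\in\mathbb{N}}$. Let $H\colon D(H)\subseteq X\to X$ be linear, densely defined and such that $H$ leaves each $X_n$ invariant, i.e. $H(D(H)\cap X_n)\subseteq X_n$. Assume moreover that $P_nH\subseteq HP_n$ holds for every $n\in\mathbb{N}$, where $P_n\in L(X)$ is the orthogonal projection onto $X_n$. Then the following conditions are equivalent. (i) $\overline{H}$ is maximal dissipative in $X$. (ii) $H_n$ is dissipative in $X_n$ and $\operatorname{Range}(1-H_n)\subseteq X_n$ is dense for every $n\in\mathbb{N}$. (iii) $\overline{H_n}$ is maximal dissipative in $X_n$ for every $n\in\mathbb{N}$. (iv) $H_n\mathcal{H}$ is dissipative in $X_{n,\mathcal{H}}$ and $\operatorname{Range}(1-H_n\mathcal{H})\subseteq X_{n,\mathcal{H}}$ is dense for every $n\in\mathbb{N}$. (v) $\overline{H_n\mathcal{H}}$ is maximal dissipative in $X_{n,\mathcal{H}}$ for every $n\in\mathbb{N}$. (vi) $\overline{H\mathcal{H}}$ is maximal dissipative in $X_{\mathcal{H}}$.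
   Context: An operator $K$ in a Hilbert space is dissipative if $\operatorname{Re}\langle Kx,x\rangle\leqslant 0$ for all $x\in D(K)$, and maximal dissipative if it is dissipative and has no proper (linear) dissipative extension. Writing $\overline{K}$ in a condition includes that $K$ is closable. A self-adjoint operator $\mathcal{H}$ in $X$ is a locally finite weight if there is an increasing sequence $(X_n)_{n\in\mathbb{N}}$ of closed subspaces of $X$ (the corresponding subspaces) such that (a) for every $n$, $X_n\subseteq D(\mathcal{H})$, $\mathcal{H}$ maps $X_n$ into $X_n$, and $\mathcal{H}_n\colon X_n\to X_n$, $x\mapsto\mathcal{H}x$, is bounded with $\mathcal{H}_n\geqslant c_n>0$ (in the sense of positive definiteness) for some constant $c_n$; (b) $\mathcal{H}|_{\bigcup_{n}X_n}$ is essentially self-adjoint in $X$. $X_{\mathcal{H}}$ denotes the completion of $\bigcup_{n}X_n$ with respect to the scalar product $\langle\cdot,\cdot\rangle_{\mathcal{H}}:=\langle\cdot,\mathcal{H}\cdot\rangle_X$; its elements are represented by Cauchy sequences in $(\bigcup_nX_n,\langle\cdot,\mathcal{H}\cdot\rangle)$. The map $P\colon D(\mathcal{H})\to X_{\mathcal{H}}$, $Px=(P_nx)_{n\in\mathbb{N}}$, is well defined and injective. $X_{n,\mathcal{H}}$ is $X_n$ equipped with $\langle\cdot,\mathcal{H}\cdot\rangle$, regarded (via $P$) as a closed subspace of $X_{\mathcal{H}}$. $H_n$ is the operator in $X_n$ with $D(H_n)=D(H)\cap X_n$, $H_nx=Hx$. $H_n\mathcal{H}$ is the operator in $X_{n,\mathcal{H}}$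 with domain $\{x\in X_n:\mathcal{H}x\in D(H_n)\}$ and $x\mapsto H_n\mathcal{H}x$. The operator $H\mathcal{H}\colon D(H\mathcal{H})\subseteq X_{\mathcal{H}}\to X_{\mathcal{H}}$ is defined by $$D(H\mathcal{H})=\{\tilde{x}\in X_{\mathcal{H}}:\exists\,x\in D(\mathcal{H})\colon Px=\tilde{x},\ \mathcal{H}x\in D(H)\text{ and }(P_nH\mathcal{H}x)_{n\in\mathbb{N}}\in X_{\mathcal{H}}\},\quad H\mathcal{H}\tilde{x}=(P_nH\mathcal{H}x)_{n\in\mathbb{N}},$$ where ''$(P_nH\mathcal{H}x)_n\in X_{\mathcal{H}}$'' means that this sequence is Cauchy in $(\bigcup_nX_n,\langle\cdot,\mathcal{H}\cdot\rangle)$. *)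

(* Defs.v *)
From HB Require Import structures.
From mathcomp Require Import all_boot all_order all_algebra.
From mathcomp Require Import ring_quotient.
From mathcomp Require Import all_classical all_reals all_analysis.
From mathcomp Require Import complex ring.

Set Implicit Arguments.
Unset Strict Implicit.
Unset Printing Implicit Defensive.

Import Order.TTheory GRing.Theory Num.Theory.
Import numFieldNormedType.Exports.

Local Open Scope classical_set_scope.
Local Open Scope quotient_scope.
Local Open Scope complex_scope.
Local Open Scope ring_scope.

(* Hilbert spaces are complex.  The order of [R[i]] is the usual partial one,
   so [0 <= z] entails that [z] is real; inner products are linear in the first
   argument and their values [<x, x>] are compared inside [R[i]]. *)

Section InnerProductSpaces.
Context {R : realType} {V : lmodType R[i]}.

Definition is_subspace (S : set V) : Prop :=
  S 0 /\ forall (a : R[i]) (x y : V), S x -> S y -> S (a *: x + y).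

(* A space whose vectors are the elements of a subset of the ambient module
   [V], with its own inner product; [form] is irrelevant outside [pts]. *)
Record ipspace := IPSpace { pts :> V -> Prop; form : V -> V -> R[i] }.

Definition is_prehilbert (E : ipspace) : Prop :=
  [/\ is_subspace (pts E),
      forall (a : R[i]) (x y z : V), E x -> E y -> E z ->
        form E (a *: x + y) z = a * form E x z + form E y z,
      forall x y : V, E x -> E y -> form E y x = (form E x y)^* &
      forall x : V, E x -> x <> 0 -> 0 < form E x x].

Record prehilbert :=
  PreHilbert { ph_space :> ipspace; ph_axioms : is_prehilbert ph_space }.

Definition sqdist (E : ipspace) (x y : V) : R[i] := form E (x - y) (x - y).

Definition ip_dense (E : ipspace) (A : set V) : Prop :=
  A `<=` pts E /\
  forall x, E x -> forall e : R[i], 0 < e -> exists2 a, A a & sqdist E x a < e.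

(* Values of [app] outside [dom] are irrelevant. *)
Record operator := Operator { dom : set V; app :> V -> V }.

Definition graph (A : operator) : set (V * V) :=
  [set p | dom A p.1 /\ p.2 = A p.1].

Definition linear_op (A : operator) : Prop :=
  is_subspace (dom A) /\
  forall (a : R[i]) (x y : V), dom A x -> dom A y ->
    A (a *: x + y) = a *: A x + A y.

Definition range_1sub (A : operator) : set V := [set x - A x | x in dom A].

Definition part (A : operator) (S : set V) : operator :=
  Operator (dom A `&` S) A.

(* The notions below concern operators given by their graphs. *)

Definition single_valued (G : set (V * V)) : Prop :=
  forall x y z : V, G (x, y) -> G (x, z) -> y = z.

Definition linear_graph (E : ipspace) (G : set (V * V)) : Prop :=
  [/\ forall p, G p -> E p.1 /\ E p.2,
      G (0, 0),
      forall (a : R[i]) (x y x' y' : V), G (x, y) -> G (x', y') ->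
        G (a *: x + x', a *: y + y') &
      single_valued G].

Definition dissipative (E : ipspace) (G : set (V * V)) : Prop :=
  forall x y : V, G (x, y) -> 'Re (form E y x) <= 0.

Definition max_dissipative (E : ipspace) (G : set (V * V)) : Prop :=
  [/\ linear_graph E G, dissipative E G &
      forall G', linear_graph E G' -> dissipative E G' -> G `<=` G' -> G' = G].

Definition graph_closure (E : ipspace) (G : set (V * V)) : set (V * V) :=
  [set p | [/\ E p.1, E p.2 & forall e : R[i], 0 < e ->
     exists2 q, G q & sqdist E p.1 q.1 < e /\ sqdist E p.2 q.2 < e]].

Definition closable (E : ipspace) (G : set (V * V)) : Prop :=
  single_valued (graph_closure E G).

Definition closure_max_dissipative (E : ipspace) (G : set (V * V)) : Prop :=
  closable E G /\ max_dissipative E (graph_closure E G).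

Definition densely_defined (E : ipspace) (G : set (V * V)) : Prop :=
  ip_dense E [set x | exists y, G (x, y)].

Definition adjoint (E : ipspace) (G : set (V * V)) : set (V * V) :=
  [set p | [/\ E p.1, E p.2 &
     forall x y : V, G (x, y) -> form E y p.1 = form E x p.2]].

Definition self_adjoint (E : ipspace) (G : set (V * V)) : Prop :=
  [/\ linear_graph E G, densely_defined E G & adjoint E G = G].

Definition ess_self_adjoint (E : ipspace) (G : set (V * V)) : Prop :=
  [/\ linear_graph E G, densely_defined E G, G `<=` adjoint E G,
      closable E G & self_adjoint E (graph_closure E G)].

End InnerProductSpaces.

Arguments ipspace {R} V.
Arguments prehilbert {R} V.
Arguments operator {R} V.

(* Completion of an inner product space: Cauchy sequences modulo null
   sequences. *)

Section CauchySequences.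
Context {R : realType} {V : lmodType R[i]} (E : prehilbert V).

Definition cauchy_in (u : nat -> V) : Prop :=
  (forall n, E (u n)) /\
  forall e : R[i], 0 < e -> exists N : nat, forall m n : nat,
    (N <= m)%N -> (N <= n)%N -> sqdist E (u m) (u n) < e.

Definition null_seq (u : nat -> V) : Prop :=
  forall e : R[i], 0 < e -> exists N : nat, forall n : nat,
    (N <= n)%N -> form E (u n) (u n) < e.

Let subE : is_subspace (pts E). Proof. by case: (ph_axioms E). Qed.

Lemma ph0 : E 0. Proof. by case: subE. Qed.

Lemma phP a x y : E x -> E y -> E (a *: x + y).
Proof. by case: subE => _; apply. Qed.

Lemma phD x y : E x -> E y -> E (x + y).
Proof. by move=> Ex Ey; rewrite -[x]scale1r; apply: phP. Qed.

Lemma phZ a x : E x -> E (a *: x).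
Proof. by move=> Ex; rewrite -[_ *: _]addr0; apply: phP => //; apply: ph0. Qed.

Lemma phN x : E x -> E (- x).
Proof. by rewrite -scaleN1r; apply: phZ. Qed.

Lemma phB x y : E x -> E y -> E (x - y).
Proof. by move=> Ex /phN; apply: phD. Qed.

Lemma formDl x y z : E x -> E y -> E z ->
  form E (x + y) z = form E x z + form E y z.
Proof.
move=> Ex Ey Ez; case: (ph_axioms E) => _ L _ _.
by have := L 1 x y z Ex Ey Ez; rewrite scale1r mul1r.
Qed.

Lemma form0l z : E z -> form E 0 z = 0.
Proof.
move=> Ez; apply: (@addrI _ (form E 0 z)).
by rewrite -formDl ?addr0//; apply: ph0.
Qed.

Lemma formZl a x z : E x -> E z -> form E (a *: x) z = a * form E x z.
Proof.
move=> Ex Ez; case: (ph_axioms E) => _ L _ _.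
by have := L a x 0 z Ex ph0 Ez; rewrite addr0 form0l// addr0.
Qed.

Lemma formC x y : E x -> E y -> form E y x = (form E x y)^*.
Proof. by case: (ph_axioms E) => _ _ + _; apply. Qed.

Lemma formDr x y z : E x -> E y -> E z ->
  form E z (x + y) = form E z x + form E z y.
Proof.
move=> Ex Ey Ez; rewrite formC ?formDl//; last exact: phD.
by rewrite rmorphD/= -!formC.
Qed.

Lemma formZr a x z : E x -> E z -> form E z (a *: x) = a^* * form E z x.
Proof.
move=> Ex Ez; rewrite formC ?formZl//; last exact: phZ.
by rewrite rmorphM/= -formC.
Qed.

Lemma form_ge0 x : E x -> 0 <= form E x x.
Proof.
move=> Ex; have [->|/eqP x0] := eqVneq x 0; first by rewrite form0l//; apply: ph0.
by case: (ph_axioms E) => _ _ _ /(_ x Ex x0)/ltW.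
Qed.

Lemma form_sqZ a x : E x -> form E (a *: x) (a *: x) = `|a| ^+ 2 * form E x x.
Proof.
move=> Ex; rewrite formZl ?formZr//; last exact: phZ.
by rewrite mulrA normCK.
Qed.

Lemma form_sqD x y : E x -> E y ->
  form E (x + y) (x + y) <= 2 * (form E x x + form E y y).
Proof.
move=> Ex Ey; rewrite -subr_ge0.
have -> : 2 * (form E x x + form E y y) - form E (x + y) (x + y)
    = form E (x - y) (x - y).
  have EN := phN Ey; have ED := phD Ex Ey; have EB := phB Ex Ey.
  have Nl z : E z -> form E (- y) z = - form E y z.
    by move=> Ez; rewrite -scaleN1r formZl// mulN1r.
  have Nr z : E z -> form E z (- y) = - form E z y.
    by move=> Ez; rewrite -scaleN1r formZr// rmorphN1 mulN1r.
  by rewrite !formDl// !formDr// !Nl// !Nr//; ring.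
by apply: form_ge0; apply: phB.
Qed.

Let split_eps_gt0 (a e : R[i]) : 0 < e ->
  0 < e / 4 / (`|a| ^+ 2 + 1) /\ 0 < e / 4.
Proof.
by move=> e0; rewrite !divr_gt0// ltr_wpDl// exprn_ge0.
Qed.

Let split_eps (a e p q : R[i]) : 0 < e -> 0 <= p ->
  p < e / 4 / (`|a| ^+ 2 + 1) -> q < e / 4 -> 2 * (`|a| ^+ 2 * p + q) < e.
Proof.
move=> e0 p0; have k0 : 0 < `|a| ^+ 2 + 1 by rewrite ltr_wpDl// exprn_ge0.
rewrite ltr_pdivlMr// mulrC => /ltW pe qe.
have -> : e = 2 * (e / 4 + e / 4) by field.
rewrite ltr_pM2l//; apply: ler_ltD qe; apply: le_trans pe.
by rewrite ler_wpM2r// lerDl.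
Qed.

Definition cauchy_pred : pred (nat -> V) := fun u => `[< cauchy_in u >].

Lemma cauchy_pred_closed : submod_closed cauchy_pred.
Proof.
split=> [|a u v].
  apply/asboolP; split=> [n|e e0]; first exact: ph0.
  by exists 0%N => m n _ _; rewrite /sqdist subrr form0l//; apply: ph0.
move=> /asboolP[Eu cu] /asboolP[Ev cv]; apply/asboolP; split=> [n|e e0].
  exact: phP.
have [/cu[N uN] /cv[M vM]] := split_eps_gt0 a e0.
exists (maxn N M) => m n; rewrite !geq_max => /andP[Nm Mm] /andP[Nn Mn].
have -> : sqdist E ((a *: u + v) m) ((a *: u + v) n)
    = form E (a *: (u m - u n) + (v m - v n)) (a *: (u m - u n) + (v m - v n)).
  by rewrite /sqdist scalerBr opprD addrACA.
have Eun : E (u m - u n) by exact: phB.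
have Evn : E (v m - v n) by exact: phB.
apply: le_lt_trans (form_sqD (phZ a Eun) Evn) _.
rewrite form_sqZ//; apply: split_eps (uN _ _ Nm Nn) (vM _ _ Mm Mn) => //.
exact: form_ge0.
Qed.

HB.instance Definition _ :=
  GRing.isSubmodClosed.Build _ _ cauchy_pred cauchy_pred_closed.

Record cauchy_seq := CauchySeq
  { cseq :> nat -> V; cseq_in : cseq \in cauchy_pred }.

HB.instance Definition _ := [isSub for cseq].
HB.instance Definition _ := [Choice of cauchy_seq by <:].
HB.instance Definition _ := [SubChoice_isSubLmodule of cauchy_seq by <:].

Definition null_pred : pred cauchy_seq := fun u => `[< null_seq u >].

Lemma cseqE (u : cauchy_seq) n : E (u n).
Proof. by have /asboolP[] := cseq_in u. Qed.

Lemma null_pred_closed : submod_closed null_pred.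
Proof.
split=> [|a u v].
  by apply/asboolP => e e0; exists 0%N => n _; rewrite form0l//; apply: ph0.
move=> /asboolP cu /asboolP cv; apply/asboolP => e e0.
have [/cu[N uN] /cv[M vM]] := split_eps_gt0 a e0.
exists (maxn N M) => n; rewrite geq_max => /andP[Nn Mn].
apply: le_lt_trans (form_sqD (phZ a (cseqE u n)) (cseqE v n)) _.
rewrite form_sqZ; last exact: cseqE.
apply: split_eps (uN _ Nn) (vM _ Mn) => //.
exact/form_ge0/cseqE.
Qed.

HB.instance Definition _ :=
  GRing.isSubmodClosed.Build _ _ null_pred null_pred_closed.

Definition completion : Type :=
  Quotient.quot (GRing.ZmodClosed.clone _ null_pred _).

HB.instance Definition _ := GRing.Zmodule.on completion.

Definition completion_class (u : cauchy_seq) : completion := \pi u.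

Lemma completion_classP (u v : cauchy_seq) :
  completion_class u = completion_class v <-> null_seq (u - v : cauchy_seq).
Proof.
rewrite (rwP eqP) /completion_class -Quotient.idealrBE.
by split=> [/asboolP//|uv]; apply/asboolP.
Qed.

Lemma completion_classK (x : completion) : completion_class (repr x) = x.
Proof. exact: reprK. Qed.

Let clD (u v : cauchy_seq) :
  completion_class (u + v) = completion_class u + completion_class v.
Proof. exact: (raddfD (\pi_completion)). Qed.

Definition completion_scale (a : R[i]) (x : completion) : completion :=
  completion_class (a *: repr x).

Let scaleE (a : R[i]) (u : cauchy_seq) :
  completion_scale a (completion_class u) = completion_class (a *: u).
Proof.
apply/eqP; rewrite -Quotient.idealrBE -scalerBr; apply: rpredZ.
by rewrite Quotient.idealrBE; apply/eqP/completion_classK.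
Qed.

Let scaleA (a b : R[i]) (x : completion) :
  completion_scale a (completion_scale b x) = completion_scale (a * b) x.
Proof. by rewrite -(completion_classK x) !scaleE scalerA. Qed.

Let scale1 : left_id 1 completion_scale.
Proof. by move=> x; rewrite -(completion_classK x) !scaleE scale1r. Qed.

Let scaleDr : right_distributive completion_scale +%R.
Proof.
move=> a x y; rewrite -(completion_classK x) -(completion_classK y).
by rewrite -clD !scaleE scalerDr clD.
Qed.

Let scaleDl (x : completion) :
  {morph completion_scale^~ x : a b / a + b}.
Proof.
by move=> a b; rewrite -(completion_classK x) !scaleE scalerDl clD.
Qed.

HB.instance Definition _ := GRing.Zmodule_isLmodule.Build R[i] completion
  scaleA scale1 scaleDr scaleDl.

(* The limit exists and does not depend on the representatives. *)
Definition completion_form (x y : completion) : R[i] :=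
  limn ((fun n => form E (repr x n) (repr y n)) : nat -> R[i]^o).

Definition completion_space : ipspace completion :=
  IPSpace (fun=> True) completion_form.

(* "The sequence [u] belongs to the completion, where it is [x]" *)
Definition represents (u : nat -> V) (x : completion) : Prop :=
  exists2 c : cauchy_seq, cseq c = u & completion_class c = x.

End CauchySequences.

Section LocallyFiniteWeights.
Context {R : realType} {X : completeNormedModType R[i]}.
Variable ip : {dot X for Num.conj}.

Definition whole_space : ipspace X := IPSpace (fun=> True) ip.

Definition sub_space (S : set X) : ipspace X := IPSpace S ip.

(* [get] yields the unique such [y] when [S] is a closed subspace and [X] is a
   Hilbert space for [ip]. *)
Definition orth_proj (S : set X) (x : X) : X :=
  get [set y | S y /\ forall z, S z -> ip (x - y) z = 0].

Record lf_weight := LFWeight {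
  weight : operator X;
  spaces : nat -> set X;
  weight_self_adjoint : self_adjoint whole_space (graph weight);
  spaces_subspace : forall n, is_subspace (spaces n);
  spaces_closed : forall n, closed (spaces n);
  spaces_increasing : forall m n, (m <= n)%N -> spaces m `<=` spaces n;
  spaces_dom : forall n, spaces n `<=` dom weight;
  spaces_invariant : forall n x, spaces n x -> spaces n (weight x);
  weight_bounded : forall n, exists M : R[i], forall x, spaces n x ->
    `|weight x| <= M * `|x|;
  weight_coercive : forall n, exists2 c : R[i], 0 < c & forall x, spaces n x ->
    c * ip x x <= ip (weight x) x;
  weight_ess_self_adjoint :
    ess_self_adjoint whole_space (graph (part weight (\bigcup_n spaces n)))
}.

Variable W : lf_weight.

Definition weighted_form (x y : X) : R[i] := ip x (weight W y).

Definition weighted_space (n : nat) : ipspace X :=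
  IPSpace (spaces W n) weighted_form.

Definition weighted_union_ip : ipspace X :=
  IPSpace (\bigcup_n spaces W n) weighted_form.

Lemma weight_symmetric (x y : X) : dom (weight W) x -> dom (weight W) y ->
  ip (weight W x) y = ip x (weight W y).
Proof.
move=> Dx Dy; have [_ _ adjW] := weight_self_adjoint W.
have : graph (weight W) (y, weight W y) by [].
by rewrite -adjW => -[_ _]; apply.
Qed.

Lemma weighted_union_prehilbert : is_prehilbert weighted_union_ip.
Proof.
have UD x : (\bigcup_n spaces W n) x -> dom (weight W) x.
  by move=> [n _]; apply: spaces_dom.
split=> /=.
- split; first by exists 0%N => //; have [] := spaces_subspace W 0.
  move=> a x y [m _ mx] [n _ ny]; exists (maxn m n) => //.
  have [_] := spaces_subspace W (maxn m n); apply.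
    exact: spaces_increasing (leq_maxl m n) _ mx.
  exact: spaces_increasing (leq_maxr m n) _ ny.
- by move=> a x y z _ _ _; rewrite /weighted_form linearDl linearZl_LR.
- move=> x y Ux Uy; rewrite /weighted_form -weight_symmetric//; try exact: UD.
  by rewrite hermC expr0 mul1r.
- move=> x [n _ nx] /eqP x0; rewrite /weighted_form.
  have [c c0 cx] := weight_coercive W n.
  rewrite -weight_symmetric; try exact: spaces_dom nx.
  apply: lt_le_trans (cx x nx).
  by rewrite mulr_gt0// dnorm_gt0.
Qed.

Definition weighted_union : prehilbert X :=
  PreHilbert weighted_union_prehilbert.

Definition weighted_completion : lmodType R[i] := completion weighted_union.

Definition weighted_completion_space : ipspace weighted_completion :=
  completion_space weighted_union.

(* [H_n W] *)
Definition weighted_part (H : operator X) (n : nat) : operator X :=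
  Operator [set x | spaces W n x /\ dom (part H (spaces W n)) (weight W x)]
           (fun x => H (weight W x)).

(* The graph of [H W] in the completion. *)
Definition weighted_graph (H : operator X) :
    set (weighted_completion * weighted_completion) :=
  [set p | exists x, [/\ dom (weight W) x,
     represents (E := weighted_union) (fun n => orth_proj (spaces W n) x) p.1,
     dom H (weight W x) &
     represents (E := weighted_union)
       (fun n => orth_proj (spaces W n) (H (weight W x))) p.2]].

End LocallyFiniteWeights.

Arguments weighted_graph {R X ip} W H.

(* Main.v *)
(* A dissipative operator K with dense domain is closable, and its closure is
   maximal dissipative as soon as 1 - K has dense range, because a dissipative
   extension is controlled by |x| <= |(1 - K) x|.  Conversely a vector z
   orthogonal to the range of 1 - K can be adjoined to the closure by
   z |-> - z, so it vanishes when the closure is maximal.  Neither argument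
   uses completeness, which is only needed to pass from "no nonzero orthogonal
   vector" to "dense", and only inside the complete spaces X_n; completeness of
   X_W is never used.

   The weight W restricts to a bijection of X_n, along which H_n and H_n W
   correspond.  A vector orthogonal to the range of 1 - H_n W gives (with
   w = W z) a pair (w, z) in the adjoint of H_n, and the adjoint is again
   dissipative, so Re <z, w> <= 0; but <z, W z> is the squared weighted norm
   of z.  The converse direction is symmetric.

   The projections P_n commute with W and H, so everything about H in X and
   about H W in X_W restricts to X_n, and conversely passes to the limit since
   the union of the X_n is dense. *)

From Pilot Require Import Defs.
From mathcomp Require Import all_boot all_order all_algebra.
From mathcomp Require Import all_classical all_reals all_analysis.
From mathcomp Require Import complex ring lra.

Set Implicit Arguments.
Unset Strict Implicit.
Unset Printing Implicit Defensive.

Import Order.TTheory GRing.Theory Num.Theory numFieldNormedType.Exports.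
(* Otherwise [form] would be that of MathComp's sesquilinear forms. *)
Import Pilot.Defs.
Local Open Scope classical_set_scope.
Local Open Scope complex_scope.
Local Open Scope ring_scope.

(** * Inner product geometry over the reals *)

Section InnerProductGeometry.
Context {R : realType} {V : lmodType R[i]}.
Implicit Types (E : prehilbert V) (x y z : V) (u v : nat -> V).

(** Dissipativity and norms see only real parts, so the analysis takes place in the underlying real
    inner product space, where values are totally ordered. Complex orthogonality is recovered in
    [form_eq0P] by scaling one argument. *)
Definition rform (E : ipspace V) x y : R := complex.Re (form E x y).

(** Depends on [form] alone, so each [X_n] has the same norm as [X], and each weighted [X_n] the
    same norm as the weighted union, by conversion. *)
Definition nrm (E : ipspace V) x : R := Num.sqrt (rform E x x).

Lemma rformC E x y : E x -> E y -> rform E x y = rform E y x.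
Proof. by move=> Ex Ey; rewrite /rform (formC Ex Ey); case: (form E x y). Qed.

Lemma rformDl E x y z : E x -> E y -> E z ->
  rform E (x + y) z = rform E x z + rform E y z.
Proof. by move=> Ex Ey Ez; rewrite /rform formDl// raddfD. Qed.

Lemma rformDr E x y z : E x -> E y -> E z ->
  rform E z (x + y) = rform E z x + rform E z y.
Proof. by move=> Ex Ey Ez; rewrite /rform formDr// raddfD. Qed.

Lemma rformNl E x z : E x -> E z -> rform E (- x) z = - rform E x z.
Proof. by move=> Ex Ez; rewrite /rform -scaleN1r formZl// mulN1r raddfN. Qed.

Lemma rformNr E x z : E x -> E z -> rform E z (- x) = - rform E z x.
Proof. by move=> Ex Ez; rewrite rformC ?rformNl 1?rformC//; apply: phN. Qed.

Lemma rformBl E x y z : E x -> E y -> E z ->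
  rform E (x - y) z = rform E x z - rform E y z.
Proof. by move=> Ex Ey Ez; rewrite rformDl ?rformNl//; apply: phN. Qed.

Lemma rformBr E x y z : E x -> E y -> E z ->
  rform E z (x - y) = rform E z x - rform E z y.
Proof. by move=> Ex Ey Ez; rewrite rformDr ?rformNr//; apply: phN. Qed.

Lemma rform0l E z : E z -> rform E 0 z = 0.
Proof. by move=> Ez; rewrite /rform form0l. Qed.

Lemma rformZl E (t : R) x z : E x -> E z ->
  rform E (t%:C *: x) z = t * rform E x z.
Proof.
by move=> Ex Ez; rewrite /rform formZl//; case: (form E x z) => a b /=; ring.
Qed.

Lemma rformZr E (t : R) x z : E x -> E z ->
  rform E z (t%:C *: x) = t * rform E z x.
Proof. by move=> Ex Ez; rewrite rformC ?rformZl 1?rformC//; apply: phZ. Qed.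

Lemma rform_adjZ E (a : R[i]) x z : E x -> E z ->
  rform E (a *: x) z = rform E x (a^* *: z).
Proof. by move=> Ex Ez; rewrite /rform formZl// formZr// conjCK. Qed.

Lemma Im_form E x y : E x -> E y ->
  complex.Im (form E x y) = rform E (- 'i *: x) y.
Proof.
by move=> Ex Ey; rewrite /rform formZl//; case: (form E x y) => a b /=; ring.
Qed.

(** The imaginary part of [<x, y>] is the real part of [<- i x, y>], so the scalars [1] and [- i]
    already determine the value. *)
Lemma form_eq0P E x y : E x -> E y ->
  form E x y = 0 <-> forall a : R[i], rform E (a *: x) y = 0.
Proof.
move=> Ex Ey; split=> [xy a|xy]; first by rewrite /rform formZl// xy mulr0.
have := xy 1; have := xy (- 'i); rewrite -Im_form// scale1r /rform.
by case: (form E x y) => a b /= -> ->.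
Qed.

Lemma form_sqE E x : E x -> form E x x = (rform E x x)%:C.
Proof. by move=> Ex; rewrite RRe_real//; apply/ger0_real/form_ge0. Qed.

Lemma rform_ge0 E x : E x -> 0 <= rform E x x.
Proof. by move=> Ex; have := form_ge0 Ex; rewrite form_sqE// lecR. Qed.

Lemma rform_eq0 E x : E x -> rform E x x <= 0 -> x = 0.
Proof.
move=> Ex le0; apply/eqP; apply: contraT => /eqP x0.
case: (ph_axioms E) => _ _ _ /(_ x Ex x0).
by rewrite form_sqE// ltcR ltNge le0.
Qed.

Lemma rform_sqZ E (a : R[i]) x : E x -> rform E (a *: x) (a *: x) =
  (complex.Re a ^+ 2 + complex.Im a ^+ 2) * rform E x x.
Proof.
move=> Ex; have := form_sqZ a Ex.
rewrite -add_Re2_Im2 !form_sqE//; last exact: phZ.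
by rewrite -rmorphM => /complexI.
Qed.

Lemma rform_CauchySchwarz E x y : E x -> E y ->
  rform E x y ^+ 2 <= rform E x x * rform E y y.
Proof.
move=> Ex Ey; have := rform_ge0 Ex; rewrite le_eqVlt => /predU1P[x0|x0].
  have -> : x = 0 by apply: (rform_eq0 Ex); rewrite -x0.
  by rewrite !rform0l ?mul0r ?expr0n//; apply: ph0.
set s := rform E x y; set q := rform E x x.
(* Expanding [|q y - s x|^2 >= 0] gives [q (q p - s^2) >= 0], and [q > 0] can be divided out. *)
have := rform_ge0 (phB (phZ q%:C Ey) (phZ s%:C Ex)).
rewrite !(rformBl, rformBr, rformZl, rformZr)//; try by do ?[apply: phB|apply: phZ].
rewrite (rformC Ey Ex) -/s -/q.
set p := rform E y y.
rewrite [leRHS](_ : _ = q * (q * p - s ^+ 2)); last by ring.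
by rewrite pmulr_rge0// subr_ge0.
Qed.

Lemma nrm_ge0 (E : ipspace V) x : 0 <= nrm E x.
Proof. exact: sqrtr_ge0. Qed.

Lemma nrm_sq E x : E x -> nrm E x ^+ 2 = rform E x x.
Proof. by move=> Ex; rewrite sqr_sqrtr// rform_ge0. Qed.

Lemma nrm0 E : nrm E 0 = 0.
Proof. by rewrite /nrm rform0l ?sqrtr0//; apply: ph0. Qed.

Lemma nrm_eq0 E x : E x -> nrm E x = 0 -> x = 0.
Proof.
by move=> Ex x0; apply: (rform_eq0 Ex); rewrite -nrm_sq// x0 expr0n.
Qed.

Lemma nrmZ E (a : R[i]) x : E x -> nrm E (a *: x) =
  Num.sqrt (complex.Re a ^+ 2 + complex.Im a ^+ 2) * nrm E x.
Proof.
by move=> Ex; rewrite /nrm rform_sqZ// sqrtrM// addr_ge0// sqr_ge0.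
Qed.

Lemma nrmN E x : E x -> nrm E (- x) = nrm E x.
Proof.
by move=> Ex; rewrite /nrm rformNl ?rformNr ?opprK//; apply: phN.
Qed.

Lemma nrm_distC E x y : E x -> E y -> nrm E (x - y) = nrm E (y - x).
Proof. by move=> Ex Ey; rewrite -opprB nrmN//; apply: phB. Qed.

Lemma rform_le E x y : E x -> E y -> `|rform E x y| <= nrm E x * nrm E y.
Proof.
move=> Ex Ey; rewrite -sqrtr_sqr -sqrtrM ?rform_ge0//.
by apply: ler_wsqrtr; apply: rform_CauchySchwarz.
Qed.

Lemma ler_nrmD E x y : E x -> E y -> nrm E (x + y) <= nrm E x + nrm E y.
Proof.
move=> Ex Ey; rewrite -ler_sqr ?nnegrE ?nrm_ge0 ?addr_ge0 ?nrm_ge0//.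
rewrite nrm_sq; last exact: phD.
rewrite !(rformDl, rformDr)//; last exact: phD.
rewrite (rformC Ey Ex) sqrrD !nrm_sq//.
have := le_trans (ler_norm _) (rform_le Ex Ey); lra.
Qed.

Lemma ler_nrmB E x y z : E x -> E y -> E z ->
  nrm E (x - z) <= nrm E (x - y) + nrm E (y - z).
Proof.
move=> Ex Ey Ez; apply: le_trans (ler_nrmD (phB Ex Ey) (phB Ey Ez)).
by rewrite addrA subrK.
Qed.

Lemma sqdist_lt E x y (r : R) : E x -> E y -> 0 < r ->
  (sqdist E x y < (r ^+ 2)%:C) = (nrm E (x - y) < r).
Proof.
move=> Ex Ey r0; rewrite /sqdist form_sqE ?ltcR -?nrm_sq; do ?exact: phB.
by rewrite ltr_sqr// nnegrE ?nrm_ge0 ?ltW.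
Qed.

(** A positive element of [R[i]] is real, hence a square; naming its root turns bounds on [sqdist]
    into bounds on [nrm]. *)
Lemma gt0_sqC (e : R[i]) : 0 < e -> exists2 r : R, 0 < r & e = (r ^+ 2)%:C.
Proof.
case: e => a b; rewrite ltcE /= => /andP[/eqP -> a0].
by exists (Num.sqrt a); rewrite ?sqrtr_gt0// sqr_sqrtr// ltW.
Qed.

End InnerProductGeometry.

(** * Convergence, density and orthogonal projection *)

Section Convergence.
Context {R : realType} {V : lmodType R[i]}.
Implicit Types (E : prehilbert V) (x y z : V) (u v : nat -> V).

Lemma squeeze_cvg0 (f g : nat -> R) :
  (\forall n \near \oo, 0 <= f n <= g n) ->
  g n @[n --> \oo] --> 0 -> f n @[n --> \oo] --> 0.
Proof. by move=> fg; apply: (squeeze_cvgr (f := fun=> 0) fg); apply: cvg_cst. Qed.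

Lemma cvgn_cst_eq (a b : R) : a @[n --> \oo] --> b -> a = b.
Proof. exact: (cvg_unique (@Rhausdorff R) (cvg_cst a)). Qed.

Definition ip_cvg (E : ipspace V) u x := nrm E (u n - x) @[n --> \oo] --> (0 : R).

Definition ip_cauchy (E : ipspace V) u := forall r : R, 0 < r ->
  exists N : nat, forall m n : nat,
    (N <= m)%N -> (N <= n)%N -> nrm E (u m - u n) < r.

Definition ip_complete (E : ipspace V) := forall u, (forall n, E (u n)) ->
  ip_cauchy E u -> exists2 x, E x & ip_cvg E u x.

Lemma ip_cvgP (E : ipspace V) u x : ip_cvg E u x <->
  forall r : R, 0 < r -> exists N : nat, forall n : nat,
    (N <= n)%N -> nrm E (u n - x) < r.
Proof.
split=> [/cvgr0Pnorm_lt ux r /ux [N _ h]|ux].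
  by exists N => n /h /=; rewrite ger0_norm// nrm_ge0.
apply/cvgr0Pnorm_lt => r /ux [N h]; exists N => // n /= /h.
by rewrite ger0_norm// nrm_ge0.
Qed.

Lemma ip_cvg_inv (E : ipspace V) u x :
  (forall n, nrm E (u n - x) < n.+1%:R^-1) -> ip_cvg E u x.
Proof.
move=> h; apply: (@squeeze_cvg0 _ (@harmonic R)) cvg_harmonic.
by near=> n; rewrite nrm_ge0 ltW.
Unshelve. all: by end_near. Qed.

Lemma ip_cvg_cst E x : E x -> ip_cvg E (fun=> x) x.
Proof. by move=> Ex; rewrite /ip_cvg subrr nrm0; apply: cvg_cst. Qed.

Lemma ip_cvg_lin E (a : R[i]) u v x y : (forall n, E (u n)) ->
  (forall n, E (v n)) -> E x -> E y -> ip_cvg E u x -> ip_cvg E v y ->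
  ip_cvg E (fun n => a *: u n + v n) (a *: x + y).
Proof.
move=> Eu Ev Ex Ey ux vy.
set k := Num.sqrt (complex.Re a ^+ 2 + complex.Im a ^+ 2).
have : k * nrm E (u n - x) + nrm E (v n - y) @[n --> \oo] --> k * 0 + 0.
  by apply: cvgD => //; apply: cvgMr.
rewrite mulr0 addr0; apply: squeeze_cvg0; near=> n; rewrite nrm_ge0/=.
rewrite opprD addrACA -scalerBr -nrmZ; last exact: phB.
by apply: ler_nrmD; [apply: phZ|]; apply: phB.
Unshelve. all: by end_near. Qed.

Lemma ip_cvgB E u v x y : (forall n, E (u n)) ->
  (forall n, E (v n)) -> E x -> E y -> ip_cvg E u x -> ip_cvg E v y ->
  ip_cvg E (fun n => u n - v n) (x - y).
Proof.
move=> Eu Ev Ex Ey ux vy; have := ip_cvg_lin (- 1) Ev Eu Ey Ex vy ux.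
rewrite scaleN1r addrC; congr ip_cvg.
by apply/funext => n; rewrite scaleN1r addrC.
Qed.

Lemma ip_cvg_rform E u v x y : (forall n, E (u n)) -> (forall n, E (v n)) ->
  E x -> E y -> ip_cvg E u x -> ip_cvg E v y ->
  rform E (u n) (v n) @[n --> \oo] --> rform E x y.
Proof.
move=> Eu Ev Ex Ey ux vy; apply/subr_cvg0; apply/norm_cvg0P.
have : nrm E (u n - x) * nrm E (v n - y) +
    (nrm E (u n - x) * nrm E y + nrm E x * nrm E (v n - y))
    @[n --> \oo] --> (0 * 0 + (0 * nrm E y + nrm E x * 0)).
  by apply: cvgD; [apply: cvgM|apply: cvgD; [apply: cvgMl|apply: cvgMr]].
rewrite !mul0r mulr0 !addr0; apply: squeeze_cvg0; near=> n; rewrite normr_ge0/=.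
have [Eun Evn] : E (u n - x) /\ E (v n - y) by split; apply: phB.
have -> : rform E (u n) (v n) - rform E x y = rform E (u n - x) (v n - y) +
    (rform E (u n - x) y + rform E x (v n - y)).
  by rewrite !(rformBl, rformBr)//; ring.
apply: le_trans (ler_normD _ _) _; apply: lerD; first exact: rform_le.
by apply: le_trans (ler_normD _ _) _; apply: lerD; apply: rform_le.
Unshelve. all: by end_near. Qed.

Lemma ip_cvg_rform0 E u x y : (forall n, E (u n)) -> E x -> E y ->
  ip_cvg E u x -> (forall n, rform E (u n) y = 0) -> rform E x y = 0.
Proof.
move=> Eu Ex Ey ux u0.
have := ip_cvg_rform Eu (fun=> Ey) Ex Ey ux (ip_cvg_cst Ey).
have -> : (fun n => rform E (u n) y) = fun=> 0 by apply/funext.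
by move=> /cvgn_cst_eq.
Qed.

Lemma ip_cvg_rform_le0 E u v x y : (forall n, E (u n)) -> (forall n, E (v n)) ->
  E x -> E y -> ip_cvg E u x -> ip_cvg E v y ->
  (forall n, rform E (u n) (v n) <= 0) -> rform E x y <= 0.
Proof.
move=> Eu Ev Ex Ey ux vy uv; have c := ip_cvg_rform Eu Ev Ex Ey ux vy.
by apply: ler_cvg_to c (cvg_cst 0) _; near=> n.
Unshelve. all: by end_near. Qed.

Lemma ip_cvg_unique E u x y : (forall n, E (u n)) -> E x -> E y ->
  ip_cvg E u x -> ip_cvg E u y -> x = y.
Proof.
move=> Eu Ex Ey ux uy; apply/eqP; rewrite -subr_eq0; apply/eqP.
have := ip_cvgB Eu Eu Ex Ey ux uy; rewrite /ip_cvg.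
have -> : (fun n => nrm E (u n - u n - (x - y))) = fun=> nrm E (x - y).
  by apply/funext => n; rewrite subrr sub0r nrmN//; apply: phB.
by move=> /cvgn_cst_eq; apply: nrm_eq0; apply: phB.
Qed.

Lemma ip_cvg_cauchy E u x : (forall n, E (u n)) -> E x ->
  ip_cvg E u x -> ip_cauchy E u.
Proof.
move=> Eu Ex /ip_cvgP ux r r0; have /ux[N h] : 0 < r / 2 by rewrite divr_gt0.
exists N => m n /h um /h un; apply: le_lt_trans (ler_nrmB (Eu m) Ex (Eu n)) _.
by rewrite (nrm_distC Ex (Eu n)); lra.
Qed.

Lemma ip_denseP E (A : set V) : ip_dense E A <-> A `<=` pts E /\
  forall x, E x -> exists2 u, forall n, A (u n) & ip_cvg E u x.
Proof.
split=> -[AE dA]; split=> // x Ex.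
  have ex n : exists a, A a /\ nrm E (a - x) < n.+1%:R^-1.
    have r0 : (0 : R) < n.+1%:R^-1 by rewrite invr_gt0.
    have [|a Aa] := dA x Ex ((n.+1%:R^-1 ^+ 2)%:C); first by rewrite ltcR exprn_gt0.
    have Ea := AE _ Aa.
    by rewrite sqdist_lt// nrm_distC// => xa; exists a.
  have [u uP] := choice ex; exists u => [n|]; first by have [] := uP n.
  by apply: ip_cvg_inv => n; have [] := uP n.
move=> e /gt0_sqC[r r0 ->]; have [u uA /ip_cvgP ux] := dA x Ex.
have [N /(_ N (leqnn N)) uN] := ux r r0; exists (u N) => //.
by rewrite sqdist_lt// 1?nrm_distC//; apply: AE.
Qed.

Lemma ip_dense_sub E (A B : set V) : ip_dense E A -> A `<=` B ->
  B `<=` pts E -> ip_dense E B.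
Proof.
move=> [_ dA] AB BE; split=> // x Ex e e0.
by have [a /AB] := dA x Ex e e0; exists a.
Qed.

Lemma ip_dense_trans E (A B : set V) : ip_dense E B -> A `<=` pts E ->
  (forall b (r : R), B b -> 0 < r -> exists2 a, A a & nrm E (b - a) < r) ->
  ip_dense E A.
Proof.
move=> [BE dB] AE AB; split=> // x Ex e /gt0_sqC[r r0 ->].
have r20 : 0 < r / 2 by rewrite divr_gt0.
have r2C : (0 : R[i]) < ((r / 2) ^+ 2)%:C by rewrite ltcR exprn_gt0.
have [b Bb] := dB x Ex _ r2C; have Eb := BE _ Bb.
rewrite sqdist_lt// => xb; have [a Aa ba] := AB b _ Bb r20.
have Ea := AE _ Aa; exists a => //; rewrite sqdist_lt//.
by apply: le_lt_trans (ler_nrmB Ex Eb Ea) _; lra.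
Qed.

Lemma dense_orth0 E (A : set V) z : ip_dense E A -> E z ->
  (forall a, A a -> rform E a z = 0) -> z = 0.
Proof.
move=> /ip_denseP[AE dA] Ez Az; have [u uA uz] := dA z Ez.
apply: (rform_eq0 Ez); rewrite (ip_cvg_rform0 _ Ez Ez uz)// => n.
  exact/AE/uA.
exact/Az/uA.
Qed.

(** * Nearest points and orthogonal projection *)

Lemma quadratic_le_eq0 (c s : R) : 0 <= s ->
  (forall t, t * c *+ 2 <= t ^+ 2 * s) -> c = 0.
Proof.
(* With this [t], for which [c = t (s + 1)], the hypothesis becomes [t^2 (s + 2) <= 0]. *)
move=> s0 /(_ (c / (s + 1))); set t := c / (s + 1).
have -> : c = t * (s + 1) by rewrite /t; field; rewrite gt_eqF//; lra.
have ts := mulr_ge0 (sqr_ge0 t) s0 => h.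
have /eqP : t ^+ 2 = 0 by apply/eqP; rewrite eq_le sqr_ge0 andbT; lra.
by rewrite sqrf_eq0 => /eqP ->; rewrite mul0r.
Qed.

(** Parallelogram identity for [x - a] and [x - b], whose half-sum is [x] minus the midpoint of [a]
    and [b]. It forces near-minimizers of the distance to [x] to be close to each other. *)
Lemma parallelogram E x a b (d : R) : E x -> E a -> E b ->
  d <= rform E (x - 2^-1%:C *: (a + b)) (x - 2^-1%:C *: (a + b)) ->
  rform E (a - b) (a - b) <=
    2 * (rform E (x - a) (x - a) - d) + 2 * (rform E (x - b) (x - b) - d).
Proof.
move=> Ex Ea Eb.
rewrite !(rformBl, rformBr)//; try by do ?[apply: phB|apply: phZ|apply: phD].
rewrite !(rformDl, rformDr, rformZl, rformZr)//; try by do ?[apply: phZ|apply: phD].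
rewrite (rformC Ea Ex) (rformC Eb Ex) (rformC Eb Ea).
lra.
Qed.

(** A minimizing sequence in [A] is Cauchy, its limit realizes the distance, and a first variation
    gives orthogonality. As [A] may fail to be closed, [y] is only a limit of points of [A]. *)
Lemma orth_projection E (A : set V) x : ip_complete E -> is_subspace A ->
  A `<=` pts E -> E x -> exists2 y, E y &
    (exists2 u, forall n, A (u n) & ip_cvg E u y) /\
    forall a, A a -> rform E a (x - y) = 0.
Proof.
move=> cE [A0 Alin] AE Ex.
set S := [set rform E (x - a) (x - a) | a in A].
have hS : has_inf S.
  split; first by exists (rform E (x - 0) (x - 0)), 0.
  by exists 0 => _ [a /AE Ea <-]; apply/rform_ge0/phB.
set d := inf S.
have d_le a : A a -> d <= rform E (x - a) (x - a).
  by move=> Aa; apply: ge_inf; [case: hS|exists a].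
have ex (n : nat) : exists a, A a /\ rform E (x - a) (x - a) < d + n.+1%:R^-1.
  have [|_ [a Aa <-] xa] := @inf_adherent _ S n.+1%:R^-1 _ hS.
    by rewrite invr_gt0.
  by exists a.
have [u uP] := choice ex.
have Au n : A (u n) by case: (uP n).
have Eu n : E (u n) by apply: AE.
have ud n : rform E (x - u n) (x - u n) - d < n.+1%:R^-1.
  by have [_] := uP n; rewrite ltrBlDl.
have ucauchy : ip_cauchy E u.
  (* The parallelogram bound doubles each of two errors, so errors below [r^2 / 4] add up to less
     than [r^2]. *)
  move=> r r0; have r20 : 0 < r ^+ 2 / 4 by rewrite divr_gt0// exprn_gt0.
  have /cvgr0Pnorm_lt/(_ _ r20)[N _ hN] := @cvg_harmonic R.
  exists N => m n Nm Nn; rewrite -ltr_sqr ?nnegrE ?nrm_ge0 ?ltW//.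
  rewrite nrm_sq; last exact: phB.
  have Amid : A (2^-1%:C *: (u m + u n)).
    rewrite -[_ *: _]addr0; apply: (Alin) => //; rewrite -[u m]scale1r.
    exact: Alin.
  have := parallelogram Ex (Eu m) (Eu n) (d_le _ Amid).
  have small k : (N <= k)%N -> rform E (x - u k) (x - u k) - d < r ^+ 2 / 4.
    move=> /hN; rewrite /= /harmonic ger0_norm ?invr_ge0//.
    exact: lt_trans (ud k).
  by have := small m Nm; have := small n Nn; lra.
have [y Ey uy] := cE u Eu ucauchy; exists y => //; split; first by exists u.
move=> a Aa; have Ea := AE _ Aa; have Exy := phB Ex Ey.
have xu : ip_cvg E (fun n => x - u n) (x - y).
  by apply: ip_cvgB => //; apply: ip_cvg_cst.
have Exu n : E (x - u n) by apply: phB.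
have zd : rform E (x - y) (x - y) <= d.
  have c := ip_cvg_rform Exu Exu Exy Exy xu xu.
  have c' : d + @harmonic R n @[n --> \oo] --> d + 0.
    by apply: cvgD; [apply: cvg_cst|apply: cvg_harmonic].
  rewrite addr0 in c'; apply: ler_cvg_to c c' _; near=> n.
  by rewrite -lerBlDl ltW.
apply: (@quadratic_le_eq0 _ (rform E a a)); first exact: rform_ge0.
move=> t; have Eta := phZ t%:C Ea.
have xuta : ip_cvg E (fun n => x - u n - t%:C *: a) (x - y - t%:C *: a).
  by apply: ip_cvgB => //; apply: ip_cvg_cst.
have Exuta n : E (x - u n - t%:C *: a) by apply: phB.
have Exyta : E (x - y - t%:C *: a) by apply: phB.
(* First variation: [y + t a] is still a limit of points of [A], so it is no nearer to [x] than [y]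
   is. Expanding the square leaves [2 t <a, x - y> <= t^2 |a|^2] for all real [t]. *)
have : d <= rform E (x - y - t%:C *: a) (x - y - t%:C *: a).
  have c := ip_cvg_rform Exuta Exuta Exyta Exyta xuta xuta.
  have cd : d @[n --> \oo] --> d by apply: cvg_cst.
  apply: ler_cvg_to cd c _; near=> n.
  by rewrite -addrA -opprD [u n + _]addrC; apply: d_le; apply: (Alin).
rewrite !(rformBl Exy Eta, rformBr Exy Eta, rformZl, rformZr)//.
rewrite (rformC Exy Ea); lra.
Unshelve. all: by end_near. Qed.

(** The residual [x - y] of the projection is orthogonal to [A] in the real sense, hence in the
    complex sense because [A] is stable under complex scalars; so it vanishes and [x] is a limit of
    points of [A]. *)
Lemma orth0_dense E (A : set V) : ip_complete E -> is_subspace A ->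
  A `<=` pts E ->
  (forall z, E z -> (forall a, A a -> form E a z = 0) -> z = 0) ->
  ip_dense E A.
Proof.
move=> cE sA AE A0; apply/ip_denseP; split=> // x Ex.
have [y Ey [[u Au uy] yP]] := orth_projection cE sA AE Ex.
exists u => //; suff /eqP : x - y = 0 by rewrite subr_eq0 => /eqP ->.
apply: A0 => [|a Aa]; first exact: phB.
have [A_0 Alin] := sA.
apply/form_eq0P => [||c]; [exact: AE|exact: phB|].
by apply: yP; rewrite -[_ *: _]addr0; apply: Alin.
Qed.

End Convergence.

(** * Dissipative linear relations *)

Section DissipativeGraphs.
Context {R : realType} {V : lmodType R[i]}.
Implicit Types (E : prehilbert V) (x y z : V) (u v : nat -> V).
Implicit Types G : set (V * V).

Lemma dissipativeP (E : ipspace V) G : dissipative E G <->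
  forall x y, G (x, y) -> rform E y x <= 0.
Proof.
by split=> dG x y /dG; rewrite /rform -complexRe lecR.
Qed.

Definition graph_range_1sub G : set V := [set p.1 - p.2 | p in G].

(** Choosing one approximating pair for each tolerance [1 / (n + 1)] turns the closure into a
    sequential one, both coordinates converging along the same pairs. *)
Lemma graph_closureP E G x y : (forall p, G p -> E p.1 /\ E p.2) ->
  graph_closure E G (x, y) <-> [/\ E x, E y & exists u v,
    [/\ forall n, G (u n, v n), ip_cvg E u x & ip_cvg E v y]].
Proof.
move=> GE; split=> [[/= Ex Ey cG]|[Ex Ey [u [v [uv /ip_cvgP ux /ip_cvgP vy]]]]].
  split=> //; have ex n : exists q, G q /\
      (nrm E (q.1 - x) < n.+1%:R^-1 /\ nrm E (q.2 - y) < n.+1%:R^-1).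
    have r0 : (0 : R) < n.+1%:R^-1 by rewrite invr_gt0.
    have [|q Gq] := cG ((n.+1%:R^-1 ^+ 2)%:C); first by rewrite ltcR exprn_gt0.
    have [Eq1 Eq2] := GE _ Gq.
    by rewrite !sqdist_lt// (nrm_distC Ex)// (nrm_distC Ey)// => xq; exists q.
  have [q qP] := choice ex; exists (fun n => (q n).1), (fun n => (q n).2).
  split=> [n||]; first by case: (qP n) => + _; case: (q n).
    by apply: ip_cvg_inv => n; have [_ []] := qP n.
  by apply: ip_cvg_inv => n; have [_ []] := qP n.
split=> //= e /gt0_sqC[r r0 ->].
have [N uN] := ux r r0; have [M vM] := vy r r0.
exists (u (maxn N M), v (maxn N M)) => //=; have [/= Eu Ev] := GE _ (uv (maxn N M)).
rewrite !sqdist_lt// (nrm_distC Ex)// (nrm_distC Ey)//.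
by split; [apply: uN; apply: leq_maxl|apply: vM; apply: leq_maxr].
Qed.

Lemma graph_closure_sub E G : (forall p, G p -> E p.1 /\ E p.2) ->
  G `<=` graph_closure E G.
Proof.
move=> GE [x y] Gxy; have [/= Ex Ey] := GE _ Gxy.
apply/graph_closureP => //; split=> //; exists (fun=> x), (fun=> y).
by split=> //; apply: ip_cvg_cst.
Qed.

Lemma graph_closure_lin E G (a : R[i]) x y x' y' :
  (forall p, G p -> E p.1 /\ E p.2) ->
  (forall (a : R[i]) x y x' y', G (x, y) -> G (x', y') ->
     G (a *: x + x', a *: y + y')) ->
  graph_closure E G (x, y) -> graph_closure E G (x', y') ->
  graph_closure E G (a *: x + x', a *: y + y').
Proof.
move=> GE Glin /(graph_closureP _ _ GE)[Ex Ey [u [v [uv ux vy]]]].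
move=> /(graph_closureP _ _ GE)[Ex' Ey' [u' [v' [uv' ux' vy']]]].
apply/graph_closureP => //; split; do ?exact: phP.
exists (fun n => a *: u n + u' n), (fun n => a *: v n + v' n).
split=> [n||]; first exact: Glin.
- by apply: ip_cvg_lin => // n; case: (GE _ (uv n)); case: (GE _ (uv' n)).
- by apply: ip_cvg_lin => // n; case: (GE _ (uv n)); case: (GE _ (uv' n)).
Qed.

Lemma dissipative_closure E G : (forall p, G p -> E p.1 /\ E p.2) ->
  dissipative E G -> dissipative E (graph_closure E G).
Proof.
move=> GE /dissipativeP dG; apply/dissipativeP => x y.
move=> /(graph_closureP _ _ GE)[Ex Ey [u [v [uv ux vy]]]].
apply: (ip_cvg_rform_le0 (E := E) _ _ Ey Ex vy ux) => n.
- by case: (GE _ (uv n)).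
- by case: (GE _ (uv n)).
- exact: dG.
Qed.

(** * Norm inequalities for dissipative pairs, closability and maximality *)

Lemma ler_nrm_sub E x y : E x -> E y -> rform E y x <= 0 ->
  nrm E x <= nrm E (x - y).
Proof.
move=> Ex Ey yx; rewrite -ler_sqr ?nnegrE ?nrm_ge0// !nrm_sq//; last exact: phB.
rewrite !(rformBl, rformBr)//; try exact: phB.
by rewrite (rformC Ex Ey); have := rform_ge0 Ey; lra.
Qed.

(** The squares differ by [4 Re <y, x>]: dissipativity says that the Cayley transform
    [x - y |-> x + y] is a contraction. *)
Lemma ler_nrm_add_sub E x y : E x -> E y ->
  (nrm E (x + y) <= nrm E (x - y)) = (rform E y x <= 0).
Proof.
move=> Ex Ey; rewrite -ler_sqr ?nnegrE ?nrm_ge0// !nrm_sq//; [|exact: phB|exact: phD].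
rewrite !(rformBl, rformBr)//; try exact: phB.
rewrite !(rformDl, rformDr)//; try exact: phD.
by rewrite (rformC Ex Ey); apply/idP/idP; lra.
Qed.

Lemma affine_le0_eq0 (c d : R) : (forall t : R, t * c + d <= 0) -> c = 0.
Proof.
move=> h; apply/eqP; apply: contraT => c0.
have := h ((1 - d) / c); rewrite divfK// subrK; lra.
Qed.

(* If (0, y) is a limit of the graph, testing dissipativity at [t p + (x, x')]
   with p close to (0, y) gives t <y, x> + <x', x> <= 0 for all real t, so y is
   orthogonal to the domain. *)
Lemma dissipative_closable E G : linear_graph E G -> dissipative E G ->
  densely_defined E G -> closable E G.
Proof.
move=> [GE _ Glin _] dG [_ dense_dom] x y z xy xz.
have Ey : E y by case: xy. have Ez : E z by case: xz.
have Eyz := phB Ey Ez.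
have cG0 : graph_closure E G (0, y - z).
  have := graph_closure_lin (- 1) GE Glin xz xy.
  by rewrite !scaleN1r ![- _ + _]addrC subrr.
have /dissipativeP dcG := dissipative_closure GE dG.
apply/eqP; rewrite -subr_eq0; apply/eqP.
have domE : [set x | exists y, G (x, y)] `<=` pts E.
  by move=> w [w' /GE[]].
apply: (dense_orth0 (conj domE dense_dom) Eyz) => w [w' ww'].
have [/= Ew Ew'] := GE _ ww'; rewrite (rformC Ew Eyz).
apply: (@affine_le0_eq0 _ (rform E w' w)) => t.
have cw := graph_closure_sub GE ww'.
have := dcG _ _ (graph_closure_lin t%:C GE Glin cG0 cw).
by rewrite scaler0 add0r (rformDl (phZ _ Eyz) Ew')// rformZl.
Qed.

(** Let [(x, y)] lie in a dissipative extension. Approximating [x - y] by differences [q.1 - q.2]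
    with [q] in [G], dissipativity forces [q.1] to tend to [x], then [q.2] tends to [y], and
    [(x, y)] is already in the closure. *)
Lemma dissipative_closure_max E G : linear_graph E G -> dissipative E G ->
  densely_defined E G -> ip_dense E (graph_range_1sub G) ->
  closure_max_dissipative E G.
Proof.
move=> lG dG ddG /ip_denseP[_ rG].
have clG := dissipative_closable lG dG ddG.
have [GE G0 Glin _] := lG; split=> //; split.
- split=> //; first by move=> p [].
    exact: graph_closure_sub.
  by move=> *; apply: graph_closure_lin.
- exact: dissipative_closure.
move=> G' [G'E _ G'lin G'sv] /dissipativeP dG' cGG'; apply/seteqP; split=> //.
move=> [x y] xy; have [/= Ex Ey] := G'E _ xy.
have [w wG wxy] := rG (x - y) (phB Ex Ey).
have ex n : exists q : V * V, G q /\ q.1 - q.2 = w n.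
  by have [q Gq <-] := wG n; exists q.
have [q qP] := choice ex.
have Eq1 n : E (q n).1 by case: (qP n) => /GE[].
have Eq2 n : E (q n).2 by case: (qP n) => /GE[].
have wE n : w n = (q n).1 - (q n).2 by case: (qP n).
have Ew n : E (w n) by rewrite wE; apply: phB.
(* Dissipativity of the difference gives |q.1 - x| <= |w - (x - y)|. *)
have qx : ip_cvg E (fun n => (q n).1) x.
  move: wxy; apply: squeeze_cvg0; near=> n; rewrite nrm_ge0/=.
  have Gq : G' (q n).
    by apply: cGG'; apply: graph_closure_sub => //; case: (qP n).
  have := G'lin (- 1) _ _ _ _ xy; move: Gq (Eq1 n) (Eq2 n) (wE n).
  case: (q n) => p p' /= Gq Ep Ep' -> /(_ _ _ Gq).
  rewrite !scaleN1r ![- _ + _]addrC => /dG'.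
  have Epx := phB Ep Ex; have Epy := phB Ep' Ey.
  have -> : p - p' - (x - y) = (p - x) - (p' - y).
    by rewrite !opprB addrACA [RHS]addrACA [- p' - x]addrC.
  exact: ler_nrm_sub.
apply/graph_closureP => //; split=> //.
exists (fun n => (q n).1), (fun n => (q n).2); split=> // [n|].
  by case: (qP n) => + _; case: (q n).
have := ip_cvgB Eq1 Ew Ex (phB Ex Ey) qx wxy.
rewrite opprB addrC subrK; congr ip_cvg; apply/funext => n.
by rewrite wE opprB addrC subrK.
Unshelve. all: by end_near. Qed.

(* Otherwise adjoining (z, - z) to the closure would give a proper dissipative
   extension. *)
Lemma max_dissipative_orth0 E G z : linear_graph E G ->
  closure_max_dissipative E G -> E z ->
  (forall x y, G (x, y) -> form E (x - y) z = 0) -> z = 0.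
Proof.
move=> [GE G0 Glin _] [clG [[cE c0 clin csv] dcG maxG]] Ez orth.
have orthc x y (a : R[i]) : graph_closure E G (x, y) ->
    rform E (x - y) (a *: z) = 0.
  move=> /(graph_closureP _ _ GE)[Ex Ey [u [v [uv ux vy]]]].
  have Eu n : E (u n) by case: (GE _ (uv n)).
  have Ev n : E (v n) by case: (GE _ (uv n)).
  have Exy := phB Ex Ey; have Euv n := phB (Eu n) (Ev n).
  apply: (ip_cvg_rform0 Euv Exy (phZ a Ez) (ip_cvgB Eu Ev Ex Ey ux vy)) => n.
  by rewrite /rform formZr// orth// mulr0.
move: (dcG) => /dissipativeP dcG'.
pose G' : set (V * V) := [set p | exists x y (a : R[i]),
  graph_closure E G (x, y) /\ p = (x + a *: z, y - a *: z)].
have GG' : graph_closure E G `<=` G'.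
  by move=> [x y] xy; exists x, y, 0; rewrite scale0r addr0 subr0.
(* The cross terms combine to [- Re <x - y, a z>], which vanishes by [orthc]; what remains is
   [Re <y, x> - |a z|^2]. *)
have diss x y (a : R[i]) : graph_closure E G (x, y) ->
    rform E (y - a *: z) (x + a *: z) <= - rform E (a *: z) (a *: z).
  move=> xy; have [/= Ex Ey] := cE _ xy; have Eaz := phZ a Ez.
  have := orthc x y a xy; have := dcG' _ _ xy.
  rewrite !rformBl//; last exact: phD.
  rewrite !rformDr// (rformC Eaz Ex); lra.
have G'lin : linear_graph E G'.
  split.
  - move=> _ [x [y [a [/cE[/= Ex Ey] ->]]]] /=.
    by split; [apply: phD|apply: phB] => //; apply: phZ.
  - exact: GG'.
  - move=> a _ _ _ _ [x [y [b [xy [-> ->]]]]] [x' [y' [b' [xy' [-> ->]]]]].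
    exists (a *: x + x'), (a *: y + y'), (a * b + b'); split; first exact: clin.
    congr pair; rewrite ?scalerDr ?scalerDl ?scalerN scalerA ?opprD addrACA//.
  - move=> _ _ _ [x [y [b [xy [-> ->]]]]] [x' [y' [b' [xy' [e ->]]]]].
    (* Two decompositions of one point put a multiple [v] of [z] into the domain of the closure,
       with value [y - y']. Orthogonality gives [|v|^2 = Re <y - y', v>], which is at most 0 by
       dissipativity, so [v = 0]. *)
    have dxy : graph_closure E G ((b' - b) *: z, y - y').
      have -> : (b' - b) *: z = x - x'.
        rewrite scalerBl; apply/eqP; rewrite subr_eq addrAC eq_sym subr_eq.
        by rewrite e addrC.
      have := clin (- 1) _ _ _ _ xy' xy.
      by rewrite !scaleN1r ![- _ + _]addrC.
    have bz0 : (b' - b) *: z = 0.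
      have [/= _ Eyy] := cE _ dxy.
      have Ebz := phZ (b' - b) Ez; apply: (rform_eq0 Ebz).
      have := orthc _ _ (b' - b) dxy; rewrite rformBl//.
      have := dcG' _ _ dxy; lra.
    rewrite bz0 in dxy.
    have := csv _ _ _ dxy c0 => /eqP; rewrite subr_eq0 => /eqP ->.
    by congr (_ - _); apply/eqP; rewrite eq_sym -subr_eq0 -scalerBl bz0.
have dG' : dissipative E G'.
  apply/dissipativeP => _ _ [x [y [a [xy [-> ->]]]]].
  by apply: le_trans (diss _ _ _ xy) _; rewrite oppr_le0; apply/rform_ge0/phZ.
have zG' : graph_closure E G (z, - z).
  rewrite -(maxG _ G'lin dG' GG').
  by exists 0, 0, 1; rewrite scale1r !add0r.
(* Now [z - (- z)] is in the range of 1 minus the closure, so [2 |z|^2 = 0]. *)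
have := orthc _ _ 1 zG'; rewrite scale1r opprK rformDl// => zz.
by apply: (rform_eq0 Ez); lra.
Qed.

(* With [p = x - y] and [q = x + y], the hypothesis on [(w, z)] reads
   <q, w - z> = <p, w + z>.  As |q| <= |p|, letting p tend to w + z yields
   |w + z| <= |w - z|. *)
Lemma adjoint_dissipative E G z w : (forall p, G p -> E p.1 /\ E p.2) ->
  dissipative E G -> ip_dense E (graph_range_1sub G) -> E z -> E w ->
  (forall x y, G (x, y) -> rform E y w = rform E x z) -> rform E z w <= 0.
Proof.
move=> GE /dissipativeP dG /ip_denseP[_ rG] Ez Ew adj.
have Ewz := phD Ew Ez; have Ewz' := phB Ew Ez.
have [p pG pw] := rG _ Ewz.
have Ep n : E (p n) by have [q /GE[Eq1 Eq2] <-] := pG n; apply: phB.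
have le n : rform E (p n) (w + z) <= nrm E (p n) * nrm E (w - z).
  have [[x y] xy <-] := pG n; have [/= Ex Ey] := GE _ xy.
  have -> : rform E (x - y) (w + z) = rform E (x + y) (w - z).
    rewrite !(rformBl, rformBr)//; last exact: phD.
    by rewrite !(rformDl, rformDr)// (adj _ _ xy); ring.
  apply: le_trans (ler_norm _) _; apply: le_trans (rform_le (phD Ex Ey) Ewz') _.
  apply: ler_wpM2r; first exact: nrm_ge0.
  by rewrite ler_nrm_add_sub//; apply: dG.
have c1 := ip_cvg_rform Ep (fun=> Ewz) Ewz Ewz pw (ip_cvg_cst Ewz).
have c2 : nrm E (p n) * nrm E (w - z) @[n --> \oo] --> nrm E (w + z) * nrm E (w - z).
  apply: cvgMl; rewrite /nrm.
  have := ip_cvg_rform Ep Ep Ewz Ewz pw pw.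
  by move=> c; apply: (cvg_comp _ _ c); apply: sqrt_continuous.
have : rform E (w + z) (w + z) <= nrm E (w + z) * nrm E (w - z).
  by apply: ler_cvg_to c1 c2 _; near=> n.
rewrite -nrm_sq// expr2 => h.
(* Divide by [|w + z|]; if it is zero, the inequality is immediate. *)
have {h} : nrm E (w + z) <= nrm E (w - z).
  have := nrm_ge0 E (w + z); rewrite le_eqVlt => /predU1P[<-|w0].
    exact: nrm_ge0.
  by move: h; rewrite ler_pM2l.
by rewrite ler_nrm_add_sub.
Unshelve. all: by end_near. Qed.

End DissipativeGraphs.

(** * The completion as an inner product space *)

Section CompletionForm.
Context {R : realType} {V : lmodType R[i]} (E : prehilbert V).
Implicit Types (c d : cauchy_seq E) (x y z : completion E).

Lemma eq_cvgn (f g : nat -> R) (l : R) :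
  f =1 g -> f n @[n --> \oo] --> l -> g n @[n --> \oo] --> l.
Proof. by move=> /funext ->. Qed.

Lemma cvgn_unique (f : nat -> R) (a b : R) :
  f n @[n --> \oo] --> a -> f n @[n --> \oo] --> b -> a = b.
Proof. exact: (cvg_unique (@Rhausdorff R)). Qed.

Lemma cvg_complex (f : nat -> R[i]) (z : R[i]) :
  complex.Re (f n) @[n --> \oo] --> complex.Re z ->
  complex.Im (f n) @[n --> \oo] --> complex.Im z ->
  (f n : R[i]^o) @[n --> \oo] --> (z : R[i]^o).
Proof.
have real (u : nat -> R) (a : R) : u n @[n --> \oo] --> a ->
    ((u n)%:C : R[i]^o) @[n --> \oo] --> (a%:C : R[i]^o).
  move=> /cvgrPdist_lt ua; apply/cvgrPdist_lt => e /gt0_sqC[r r0 ->].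
  have r20 : 0 < r ^+ 2 by rewrite exprn_gt0.
  near=> n; rewrite -rmorphB normc_def/= expr0n addr0 sqrtr_sqr ltcR.
  by near: n; apply: ua.
move=> /real fR /real fI; rewrite [z]complexE.
under eq_fun do rewrite [f _]complexE.
by apply: cvgD fR _; apply: cvgMr fI.
Unshelve. all: by end_near. Qed.

Lemma cauchy_seq_ip_cauchy c : ip_cauchy E c.
Proof.
have /asboolP[Ec cc] := cseq_in c; move=> r r0.
have [|N cN] := cc ((r ^+ 2)%:C); first by rewrite ltcR exprn_gt0.
by exists N => m n Nm Nn; rewrite -sqdist_lt//; apply: cN.
Qed.

Lemma null_seqP (u : nat -> V) : (forall n, E (u n)) ->
  null_seq E u <-> ip_cvg E u 0.
Proof.
move=> Eu; have sq n : form E (u n) (u n) = sqdist E (u n) 0.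
  by rewrite /sqdist subr0.
split=> [nu|/ip_cvgP nu].
  apply/ip_cvgP => r r0; have [|N h] := nu ((r ^+ 2)%:C).
    by rewrite ltcR exprn_gt0.
  by exists N => n /h; rewrite sq sqdist_lt//; apply: ph0.
move=> e /gt0_sqC[r r0 ->]; have [N h] := nu r r0.
by exists N => n /h; rewrite sq sqdist_lt//; apply: ph0.
Qed.

Lemma cvgn_cauchy (f : nat -> R) :
  (forall e, 0 < e -> exists N, forall n, (N <= n)%N -> `|f N - f n| < e) ->
  cvgn f.
Proof.
move=> fc; apply: cauchy_cvg; apply/cauchy_exP => e /fc[N h].
by exists (f N), N => // n /= /h.
Qed.

(** By the reverse triangle inequality the norms form a Cauchy sequence of reals. *)
Lemma is_cvg_nrm c : cvgn (fun n => nrm E (c n)).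
Proof.
apply: cvgn_cauchy => e /(cauchy_seq_ip_cauchy c)[N h]; exists N => n Nn.
apply: le_lt_trans (h N n (leqnn N) Nn).
have [EN En] := (cseqE c N, cseqE c n).
have : nrm E (c N) <= nrm E (c N - c n) + nrm E (c n).
  by rewrite -{1}(subrK (c n) (c N)); apply: ler_nrmD => //; apply: phB.
have : nrm E (c n) <= nrm E (c N - c n) + nrm E (c N).
  rewrite -{1}(subrK (c N) (c n)) (nrm_distC EN)//.
  by apply: ler_nrmD => //; apply: phB.
by rewrite ler_norml; lra.
Qed.

(** Polarization reduces inner products to the squared norms of the Cauchy sequences [c + d] and
    [c - d]. *)
Lemma is_cvg_rform c d : cvgn (fun n => rform E (c n) (d n)).
Proof.
have sq (e : cauchy_seq E) : cvgn (fun n => rform E (e n) (e n)).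
  have -> : (fun n => rform E (e n) (e n)) = (fun n => nrm E (e n) ^+ 2).
    by apply/funext => n; rewrite nrm_sq//; apply: cseqE.
  by under eq_fun do rewrite expr2; apply: is_cvgM; apply: is_cvg_nrm.
have -> : (fun n => rform E (c n) (d n)) =
    (fun n => 4^-1 * (rform E ((c + d : cauchy_seq E) n) ((c + d : cauchy_seq E) n)
                      - rform E ((c - d : cauchy_seq E) n) ((c - d : cauchy_seq E) n))).
  apply/funext => n; have [Ec Ed] := (cseqE c n, cseqE d n).
  rewrite !(rformBl, rformBr)//; try exact: phB.
  rewrite !(rformDl, rformDr)//; try exact: phD.
  by rewrite (rformC Ed Ec); field.
by apply: is_cvgMr; apply: is_cvgB; apply: sq.
Qed.

(** A change of representative alters the inner products by [<c - c', d>], a null sequence paired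
    with one of convergent norm. *)
Lemma rform_null c c' d (l : R) :
  completion_class c = completion_class c' ->
  rform E (c n) (d n) @[n --> \oo] --> l ->
  rform E (c' n) (d n) @[n --> \oo] --> l.
Proof.
move=> cc cl.
have cc' := (null_seqP (cseqE (c - c'))).1 ((completion_classP c c').1 cc).
have [k kd] : exists k : R, nrm E (d n) @[n --> \oo] --> k.
  by exists (limn (fun n => nrm E (d n))); apply: is_cvg_nrm.
have d0 : rform E ((c - c' : cauchy_seq E) n) (d n) @[n --> \oo] --> 0.
  apply/norm_cvg0P.
  have : nrm E ((c - c' : cauchy_seq E) n - 0) * nrm E (d n) @[n --> \oo] --> 0 * k.
    exact: cvgM.
  rewrite mul0r.
  apply: squeeze_cvg0; near=> n; rewrite normr_ge0/= subr0.
  exact: (rform_le (cseqE (c - c') n) (cseqE d n)).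
have : rform E (c n) (d n) - rform E ((c - c' : cauchy_seq E) n) (d n)
    @[n --> \oo] --> l - 0 by exact: cvgB.
rewrite subr0; apply: eq_cvgn => n.
have [Ec Ec'] := (cseqE c n, cseqE c' n); have Ed := cseqE d n.
by rewrite rformBl// opprB addrC subrK.
Unshelve. all: by end_near. Qed.

Lemma completion_classD c d :
  completion_class (c + d) = completion_class c + completion_class d.
Proof. exact: (raddfD (\pi_(completion E))%qT). Qed.

Lemma completion_classZ (a : R[i]) c :
  completion_class (a *: c) = a *: completion_class c.
Proof.
have /completion_classP nc := completion_classK (completion_class c).
apply/esym/completion_classP; rewrite -scalerBr.
have [n0 /(_ a _ 0 _ n0)] := null_pred_closed E.
move=> h; have := h (repr (completion_class c) - c); rewrite addr0 => {}h.
by apply/asboolP/h/asboolP.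
Qed.

(** The form of the completion is a limit along chosen representatives; here any representatives are
    shown to give the same limit. The imaginary part is handled as the real form of [- i c] and
    [d]. *)
Let form_repr_cvg c d (x := completion_class c) (y := completion_class d) :
  rform E (c n) (d n) @[n --> \oo] --> complex.Re (completion_form x y) /\
  rform E (- 'i *: c n) (d n) @[n --> \oo] --> complex.Im (completion_form x y).
Proof.
have cR := @is_cvg_rform (repr x) (repr y).
have cI := @is_cvg_rform (- 'i *: repr x) (repr y).
set a := limn _ in cR; set b := limn _ in cI.
have ImE n : complex.Im (form E (repr x n) (repr y n)) =
    rform E ((- 'i *: repr x : cauchy_seq E) n) (repr y n).
  by rewrite Im_form//; apply: cseqE.
have xy : (form E (repr x n) (repr y n) : R[i]^o) @[n --> \oo] --> (a +i* b : R[i]^o).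
  by apply: cvg_complex => //=; under eq_fun do rewrite ImE.
have -> : completion_form x y = a +i* b.
  by apply: cvg_lim xy; apply: norm_hausdorff.
(* Representatives are exchanged one argument at a time, using the symmetry of the real form for the
   second. *)
have tr (z : R[i]) (l : R) :
    rform E ((z *: repr x : cauchy_seq E) n) (repr y n) @[n --> \oo] --> l ->
    rform E ((z *: c : cauchy_seq E) n) (d n) @[n --> \oo] --> l.
  have xc : completion_class (z *: repr x) = completion_class (z *: c).
    by rewrite !completion_classZ completion_classK.
  move=> /(rform_null xc) h.
  have {}h : rform E (repr y n) ((z *: c : cauchy_seq E) n) @[n --> \oo] --> l.
    by apply: eq_cvgn h => n; apply: rformC; apply: cseqE.
  have {}h := rform_null (completion_classK y) h.
  by apply: eq_cvgn h => n; apply: rformC; apply: cseqE.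
split; last exact: (tr _ _ cI).
by have := tr 1 a; rewrite !scale1r; apply.
Qed.

Lemma cvg_rform_completion c d : rform E (c n) (d n) @[n --> \oo] -->
  rform (completion_space E) (completion_class c) (completion_class d).
Proof. by have [] := form_repr_cvg c d. Qed.

Lemma completion_surj x : exists c, completion_class c = x.
Proof. by exists (repr x); apply: completion_classK. Qed.

Let rform_completionD x y z : rform (completion_space E) (x + y) z =
  rform (completion_space E) x z + rform (completion_space E) y z.
Proof.
have [c <-] := completion_surj x; have [d <-] := completion_surj y.
have [e <-] := completion_surj z.
rewrite -completion_classD; apply: (cvgn_unique (@cvg_rform_completion (c + d) e)).
have : rform E (c n) (e n) + rform E (d n) (e n) @[n --> \oo] -->
    rform (completion_space E) (completion_class c) (completion_class e) +
    rform (completion_space E) (completion_class d) (completion_class e).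
  by apply: cvgD; apply: cvg_rform_completion.
apply: eq_cvgn => n /=.
by rewrite -rformDl//; apply: cseqE.
Qed.

Let rform_completionC x y : rform (completion_space E) x y =
  rform (completion_space E) y x.
Proof.
have [c <-] := completion_surj x; have [d <-] := completion_surj y.
apply: (cvgn_unique (@cvg_rform_completion c d)).
have := @cvg_rform_completion d c.
apply: eq_cvgn => n /=.
by apply: rformC; apply: cseqE.
Qed.

Let rform_completionZ (t : R) x z : rform (completion_space E) (t%:C *: x) z =
  t * rform (completion_space E) x z.
Proof.
have [c <-] := completion_surj x; have [e <-] := completion_surj z.
rewrite -completion_classZ.
apply: (cvgn_unique (@cvg_rform_completion (t%:C *: c) e)).
have : t * rform E (c n) (e n) @[n --> \oo] -->
    t * rform (completion_space E) (completion_class c) (completion_class e).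
  by apply: cvgMr; apply: cvg_rform_completion.
apply: eq_cvgn => n /=.
by rewrite -rformZl//; apply: cseqE.
Qed.

Let rform_completion_adji x y : rform (completion_space E) ('i *: x) y =
  - rform (completion_space E) x ('i *: y).
Proof.
have [c <-] := completion_surj x; have [d <-] := completion_surj y.
rewrite -!completion_classZ.
apply: (cvgn_unique (@cvg_rform_completion ('i *: c) d)).
have : - rform E (c n) (('i *: d : cauchy_seq E) n) @[n --> \oo] -->
    - rform (completion_space E) (completion_class c)
        (completion_class ('i *: d)) by apply: cvgN; apply: cvg_rform_completion.
apply: eq_cvgn => n /=.
have [Ex Ey] := (cseqE c n, cseqE d n).
by rewrite rform_adjZ// conjCi scaleNr rformNr//; apply: phZ.
Qed.

Let Im_completion_form x y : complex.Im (completion_form x y) =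
  - rform (completion_space E) ('i *: x) y.
Proof.
have [c <-] := completion_surj x; have [d <-] := completion_surj y.
rewrite -!completion_classZ.
have [_ h] := form_repr_cvg c d.
apply: (cvgn_unique h).
have : - rform E (('i *: c : cauchy_seq E) n) (d n) @[n --> \oo] -->
    - rform (completion_space E) (completion_class ('i *: c))
        (completion_class d) by apply: cvgN; apply: cvg_rform_completion.
apply: eq_cvgn => n /=.
have [Ex Ey] := (cseqE c n, cseqE d n).
by rewrite scaleNr rformNl//; apply: phZ.
Qed.

(** The real identities above are limits of those in [E]; complex linearity and conjugate symmetry
    are reassembled from real and imaginary parts. *)
Lemma completion_prehilbert : is_prehilbert (completion_space E).
Proof.
split=> //=.
- move=> a x y z _ _ _; apply/eqP; rewrite eq_complex; apply/andP.
  have iZ b w : rform (completion_space E) (b *: w) z =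
      complex.Re b * rform (completion_space E) w z +
      complex.Im b * rform (completion_space E) ('i *: w) z.
    have {1}-> : b = (complex.Re b)%:C + (complex.Im b)%:C * 'i.
      by rewrite {1}[b]complexE mulrC complexiE.
    by rewrite scalerDl rform_completionD -scalerA !rform_completionZ.
  have ReE w : complex.Re (completion_form w z) = rform (completion_space E) w z.
    by [].
  split; apply/eqP.
    rewrite raddfD/= ReE rform_completionD iZ -ReE.
    have := Im_completion_form x z; rewrite /rform/=.
    case: a => a b; case: (completion_form x z) => p q /= ->.
    by ring.
  rewrite raddfD/= !Im_completion_form scalerDr rform_completionD opprD.
  congr (_ + _); rewrite scalerA mulrC -scalerA iZ.
  have -> : rform (completion_space E) ('i *: ('i *: x)) z =
      - rform (completion_space E) x z.
    by have := rform_completionZ (- 1) x z; rewrite scalerA mulCii rmorphN1 mulN1r.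
  have := Im_completion_form x z; rewrite -!ReE.
  case: a => a b; case: (completion_form x z) => p q /= ->.
  by ring.
- move=> x y _ _; apply/eqP; rewrite eq_complex; apply/andP; split; apply/eqP.
    have := rform_completionC y x; rewrite /rform/= => ->.
    by case: (completion_form x y).
  have -> : complex.Im (completion_form x y)^* = - complex.Im (completion_form x y).
    by case: (completion_form x y).
  by rewrite !Im_completion_form rform_completionC rform_completion_adji opprK.
- move=> x _ x0.
  have Im0 : complex.Im (completion_form x x) = 0.
    rewrite Im_completion_form; have := rform_completion_adji x x.
    rewrite rform_completionC; lra.
  have c : nrm E (repr x n) ^+ 2 @[n --> \oo] --> complex.Re (completion_form x x).
    have := @cvg_rform_completion (repr x) (repr x).
    rewrite completion_classK; apply: eq_cvgn => n.
    by rewrite nrm_sq//; apply: cseqE.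
  have ge0 : 0 <= complex.Re (completion_form x x).
    by apply: ler_cvg_to (cvg_cst 0) c _; near=> n; rewrite sqr_ge0.
  rewrite ltcE/= Im0 eqxx/= lt_neqAle ge0 andbT.
  (* If the limit of [|x_n|^2] were zero, continuity of the square root would make the
     representative a null sequence, whose class is zero. *)
  apply/eqP => Re0; apply: x0; rewrite -(completion_classK x).
  have <- : completion_class (0 : cauchy_seq E) = 0.
    exact: (raddf0 (\pi_(completion E))%qT).
  apply/completion_classP; rewrite subr0; apply/(null_seqP (cseqE _)).
  rewrite -Re0 in c.
  have := cvg_comp _ _ c (@sqrt_continuous R 0); rewrite sqrtr0.
  apply: eq_cvgn => n /=.
  by rewrite subr0 sqrtr_sqr ger0_norm// nrm_ge0.
Unshelve. all: by end_near. Qed.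

Definition completion_ph := PreHilbert completion_prehilbert.

Lemma cvg_nrm_completion c :
  nrm E (c n) @[n --> \oo] --> nrm (completion_space E) (completion_class c).
Proof. exact: (cvg_comp _ _ (@cvg_rform_completion c c) (@sqrt_continuous R _)). Qed.

End CompletionForm.

(** * The ambient Hilbert space *)

Section HilbertSpace.
Context {R : realType} {X : completeNormedModType R[i]}.
Context (ip : {dot X for Num.conj}) (ip_norm : forall x : X, `|x| ^+ 2 = ip x x).
Implicit Types (x y z : X) (S : set X).

Lemma dot_linl (a : R[i]) x y z : ip (a *: x + y) z = a * ip x z + ip y z.
Proof. by rewrite linearDl linearZl_LR. Qed.

Lemma dotBl x y z : ip (x - y) z = ip x z - ip y z.
Proof. by rewrite linearBl. Qed.

Lemma dot_prehilbert S : is_subspace S -> is_prehilbert (sub_space ip S).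
Proof.
move=> sS; split=> //=.
- by move=> a x y z _ _ _; apply: dot_linl.
- by move=> x y _ _; rewrite hermC expr0 mul1r.
- by move=> x _ /eqP x0; rewrite dnorm_gt0.
Qed.

Lemma whole_prehilbert : is_prehilbert (whole_space ip).
Proof. by apply: (@dot_prehilbert setT); split. Qed.

Canonical whole_ph := PreHilbert whole_prehilbert.

Lemma norm_nrm x : `|x| = (nrm (whole_space ip) x)%:C.
Proof.
apply/eqP; rewrite -(@eqrXn2 _ 2)//; last by rewrite lecR nrm_ge0.
by rewrite ip_norm -rmorphXn/= nrm_sq// -form_sqE.
Qed.

Lemma ip_cvgE (u : nat -> X) x :
  ip_cvg (whole_space ip) u x <-> u n @[n --> \oo] --> x.
Proof.
split=> [/ip_cvgP ux|/cvgrPdist_lt ux].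
  apply/cvgrPdist_lt => e /gt0_sqC[r r0 ->].
  (* The norm of [X] is not squared, so [r ^+ 2], which is [e] itself, serves as the tolerance. *)
  have [|N uN] := ux (r ^+ 2); first by rewrite exprn_gt0.
  by exists N => // n /= /uN; rewrite norm_nrm ltcR nrm_distC.
apply/ip_cvgP => r r0; have [|N _ uN] := ux r%:C; first by rewrite ltcR.
by exists N => n /uN /=; rewrite norm_nrm ltcR nrm_distC.
Qed.

Lemma sub_complete S : closed S -> ip_complete (sub_space ip S).
Proof.
move=> cS u Su uc.
have /cvg_ex[x ux] : cvgn u.
  apply: cauchy_cvg; apply/cauchy_exP => e /gt0_sqC[r r0 ->].
  have [|N uN] := uc (r ^+ 2); first by rewrite exprn_gt0.
  exists (u N), N => // n /= Nn; rewrite -ball_normE /= norm_nrm ltcR.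
  exact: uN.
exists x; last exact/ip_cvgE.
by apply: (closed_cvg S cS _ _ ux); exists 0%N => // n _; apply: Su.
Qed.

Lemma whole_complete : ip_complete (whole_space ip).
Proof. by apply: (@sub_complete setT); apply: closedT. Qed.

Lemma dense_ip_dense (A : set X) : dense A -> ip_dense (whole_space ip) A.
Proof.
move=> dA; split=> // x _ e /gt0_sqC[r r0 ->].
have rC : (0 : R[i]) < r%:C by rewrite ltcR.
have [||a [xa Aa]] := dA (ball x r%:C)^°.
- exists x; exact: nbhsx_ballx.
- exact: open_interior.
exists a => //; rewrite sqdist_lt//.
by have := interior_subset xa; rewrite -ball_normE /= norm_nrm ltcR.
Qed.

(** Shows that the condition under [get] can be met: the projection theorem yields a limit of points
    of [S], and closedness puts it in [S]. *)
Lemma orth_projP S x : closed S -> is_subspace S ->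
  S (orth_proj ip S x) /\ forall z, S z -> ip (x - orth_proj ip S x) z = 0.
Proof.
move=> cS sS; rewrite /orth_proj; apply: (@getPex _ [set y | S y /\ _]).
have [||y _ [[u Su uy] yP]] := @orth_projection _ _ whole_ph _ x whole_complete sS => //.
exists y; split.
  move/ip_cvgE: uy => uy.
  by apply: (closed_cvg S cS _ _ uy); exists 0%N => // n _; apply: Su.
move=> z Sz; have -> : ip (x - y) z = form (whole_space ip) (x - y) z by [].
rewrite (formC (x := z))//= -[RHS](rmorph0 Num.conj); congr (_^*).
apply/(@form_eq0P _ _ whole_ph) => // a; apply: yP.
by case: sS => S0 Slin; rewrite -[_ *: _]addr0; apply: Slin.
Qed.

(** The difference of two candidates lies in [S] and is also a difference of two residuals
    orthogonal to [S], so it is orthogonal to itself. *)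
Lemma orth_proj_unique S x y : closed S -> is_subspace S -> S y ->
  (forall z, S z -> ip (x - y) z = 0) -> orth_proj ip S x = y.
Proof.
move=> cS sS Sy yP; have [SP PP] := orth_projP x cS sS.
apply/eqP; rewrite -subr_eq0 -(dnorm_eq0 ip); set d := _ - y.
have Sd : S d.
  by case: sS => _ Slin; rewrite /d addrC -scaleN1r; apply: Slin.
have dE : d = (x - y) - (x - orth_proj ip S x).
  by rewrite opprB [RHS]addrC addrA subrK.
have -> : ip d d = ip (x - y) d - ip (x - orth_proj ip S x) d.
  by rewrite {1}dE dotBl.
by rewrite yP// PP// subrr.
Qed.

End HilbertSpace.

(** * The weight on its subspaces *)

Section Weight.
Context {R : realType} {X : completeNormedModType R[i]}.
Context (ip : {dot X for Num.conj}) (ip_norm : forall x : X, `|x| ^+ 2 = ip x x).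
Context (W : lf_weight ip).
Implicit Types (x y z : X) (n : nat).

Local Notation w := (weight W).
Local Notation "'X_ n" := (spaces W n) (at level 8, n at level 2, format "''X_' n").
Local Notation P n := (orth_proj ip 'X_n).
Local Notation N := (nrm (whole_space ip)).
Local Notation NW := (nrm (weighted_union_ip W)).

Lemma spaces0 n : 'X_n 0.
Proof. by case: (spaces_subspace W n). Qed.

Lemma spaces_lin n (a : R[i]) x y : 'X_n x -> 'X_n y -> 'X_n (a *: x + y).
Proof. by case: (spaces_subspace W n) => _; apply. Qed.

Lemma spacesB n x y : 'X_n x -> 'X_n y -> 'X_n (x - y).
Proof. by move=> nx ny; rewrite addrC -scaleN1r; apply: spaces_lin. Qed.

Lemma weight_lin (a : R[i]) x y : dom w x -> dom w y ->
  dom w (a *: x + y) /\ w (a *: x + y) = a *: w x + w y.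
Proof.
case: (weight_self_adjoint W) => -[_ _ Glin _] _ _ Dx Dy.
by have [] := Glin a x (w x) y (w y) (conj Dx erefl) (conj Dy erefl).
Qed.

Lemma weightB x y : dom w x -> dom w y ->
  dom w (x - y) /\ w (x - y) = w x - w y.
Proof.
move=> Dx Dy; have := weight_lin (- 1) Dy Dx.
by rewrite !scaleN1r ![- _ + _]addrC.
Qed.

Canonical spaces_ph n := PreHilbert (dot_prehilbert ip (spaces_subspace W n)).

Lemma spaces_union n x : 'X_n x -> weighted_union_ip W x.
Proof. by exists n. Qed.

Lemma weighted_prehilbert n : is_prehilbert (weighted_space W n).
Proof.
case: (weighted_union_prehilbert W) => _ lin her pos; split=> /=.
- exact: spaces_subspace.
- by move=> a x y z /spaces_union ? /spaces_union ? /spaces_union ?; apply: lin.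
- by move=> x y /spaces_union ? /spaces_union ?; apply: her.
- by move=> x /spaces_union ?; apply: pos.
Qed.

Canonical weighted_ph n := PreHilbert (weighted_prehilbert n).

Lemma spaces_complete n : ip_complete (sub_space ip 'X_n).
Proof. exact/(sub_complete ip_norm)/spaces_closed. Qed.

Lemma proj_in n x : 'X_n (P n x).
Proof. by case: (orth_projP ip_norm x (@spaces_closed _ _ _ W n) (spaces_subspace W n)). Qed.

Lemma proj_orth n x z : 'X_n z -> ip (x - P n x) z = 0.
Proof.
by case: (orth_projP ip_norm x (@spaces_closed _ _ _ W n) (spaces_subspace W n)) => _; apply.
Qed.

Lemma proj_unique n x y : 'X_n y -> (forall z, 'X_n z -> ip (x - y) z = 0) -> P n x = y.
Proof. exact: (orth_proj_unique ip_norm (@spaces_closed _ _ _ W n) (spaces_subspace W n)). Qed.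

Lemma dot_projl n x z : 'X_n z -> ip (P n x) z = ip x z.
Proof. by move=> /(proj_orth x)/eqP; rewrite dotBl subr_eq0 => /eqP. Qed.

Lemma proj_id n x : 'X_n x -> P n x = x.
Proof. by move=> nx; apply: proj_unique => // z _; rewrite subrr linear0l. Qed.

Lemma proj_lin n (a : R[i]) x y : P n (a *: x + y) = a *: P n x + P n y.
Proof.
apply: proj_unique => [|z nz]; first by apply: spaces_lin; apply: proj_in.
rewrite opprD addrACA -scalerBr dot_linl.
by rewrite !proj_orth// mulr0 addr0.
Qed.

Lemma projB n x y : P n (x - y) = P n x - P n y.
Proof. by rewrite addrC -scaleN1r proj_lin scaleN1r addrC. Qed.

(* Self-adjointness: <W x, v> = <x, W v> = <P_n x, W v> for v in X_n. *)
Lemma proj_weight n x : dom w x -> P n (w x) = w (P n x).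
Proof.
move=> Dx; have Pn := proj_in n x; have DP := spaces_dom Pn.
apply: proj_unique => [|z nz]; first exact: spaces_invariant.
have Dz := spaces_dom nz.
rewrite dotBl !weight_symmetric// dot_projl ?subrr//.
exact: spaces_invariant.
Qed.

(** On [X_n] both norms are equivalent and the weight is bounded above and below. Everything follows
    from boundedness, coercivity and [k^2 |x|^2 <= |x|_W^2 <= |x| |W x|]. *)
Lemma weight_bounds n : exists2 C : R, 0 < C & forall x, 'X_n x ->
  [/\ NW x <= C * N x, N x <= C * NW x, N (w x) <= C * N x & N x <= C * N (w x)].
Proof.
have [M Mw] := weight_bounded W n; have [c c0 cw] := weight_coercive W n.
(* The bound [M] is complex and only its real part matters; the maximum with 1 ensures [m <= m^2],
   needed to pass from [|x|_W^2 <= m |x|^2] to [|x|_W <= m |x|]. *)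
pose m := Num.max 1 (complex.Re M).
have m1 : 1 <= m by rewrite le_max lexx.
have wx x : 'X_n x -> N (w x) <= m * N x.
  move=> /Mw; rewrite !(norm_nrm ip_norm) lecE /= => /andP[_ h].
  have {}h : N (w x) <= complex.Re M * N x by move: h; case: (M) => a b /=; lra.
  apply: le_trans h _; apply: ler_wpM2r; first exact: nrm_ge0.
  by rewrite le_max lexx orbT.
have NW2 x : 'X_n x -> NW x ^+ 2 = rform (whole_space ip) x (w x).
  by move=> nx; rewrite (nrm_sq (E := weighted_ph n)).
have [k k0 kw] : exists2 k : R, 0 < k & forall x, 'X_n x ->
    k ^+ 2 * N x ^+ 2 <= NW x ^+ 2.
  have [k k0 ck] := gt0_sqC c0; exists k => // x nx; have := cw x nx.
  rewrite ck NW2// nrm_sq// lecE => /andP[_]; rewrite (rformC (E := whole_ph ip))//.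
  rewrite /rform /=; case: (ip x x) => a b /=; lra.
have CS x : 'X_n x -> NW x ^+ 2 <= N x * N (w x).
  by move=> nx; rewrite NW2//; apply: le_trans (ler_norm _) (rform_le _ _).
have kN x : 'X_n x -> k * N x <= NW x.
  move=> /kw; rewrite -exprMn ler_sqr// nnegrE ?nrm_ge0//.
  by rewrite mulr_ge0 ?nrm_ge0// ltW.
have k2N x : 'X_n x -> k ^+ 2 * N x <= N (w x).
  move=> nx; have := nrm_ge0 (whole_space ip) x; rewrite le_eqVlt => /predU1P[<-|N0].
    by rewrite mulr0 nrm_ge0.
  by rewrite -(ler_pM2l N0) mulrCA -expr2; apply: le_trans (kw _ nx) (CS _ nx).
have NWm x : 'X_n x -> NW x <= m * N x.
  move=> nx; have m0 : 0 <= m by lra.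
  rewrite -ler_sqr ?nnegrE ?nrm_ge0 ?mulr_ge0 ?nrm_ge0//.
  apply: le_trans (CS _ nx) _; rewrite exprMn expr2 -mulrA.
  have := wx x nx; have := nrm_ge0 (whole_space ip) x => N0 h.
  apply: le_trans (ler_wpM2l N0 h) _; rewrite mulrCA -expr2 ler_peMl//.
  by rewrite mulr_ge0// sqr_ge0.
have k20 : 0 < k ^+ 2 by rewrite exprn_gt0.
(* A sum of positive terms dominating each of the constants [m], [1 / k] and [1 / k^2]. *)
exists (m + k^-1 + (k ^+ 2)^-1).
  by rewrite !addr_gt0 ?invr_gt0//; lra.
move=> x nx; have N0 := nrm_ge0 (whole_space ip) x.
have NW0 := nrm_ge0 (weighted_union_ip W) x.
have Nw0 := nrm_ge0 (whole_space ip) (w x).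
have [i0 j0] : 0 < k^-1 /\ 0 < (k ^+ 2)^-1 by rewrite !invr_gt0.
have mono (a t : R) : 0 <= t -> a <= m + k^-1 + (k ^+ 2)^-1 ->
    a * t <= (m + k^-1 + (k ^+ 2)^-1) * t by move=> t0; apply: ler_wpM2r.
split.
- by apply: le_trans (NWm _ nx) (mono _ _ N0 _); lra.
- apply: le_trans (mono _ _ NW0 (_ : k^-1 <= _)); last by lra.
  by rewrite mulrC ler_pdivlMr// mulrC; apply: kN.
- by apply: le_trans (wx _ nx) (mono _ _ N0 _); lra.
- apply: le_trans (mono _ _ Nw0 (_ : (k ^+ 2)^-1 <= _)); last by lra.
  by rewrite mulrC ler_pdivlMr// mulrC; apply: k2N.
Qed.

Lemma weighted_cvgE n (u : nat -> X) x : (forall k, 'X_n (u k)) -> 'X_n x ->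
  ip_cvg (weighted_space W n) u x <-> ip_cvg (whole_space ip) u x.
Proof.
move=> nu nx; have [C C0 CP] := weight_bounds n.
have le0 (f g : nat -> R) : (forall k, 0 <= f k) ->
    (forall k, f k <= C * g k) -> g k @[k --> \oo] --> 0 -> f k @[k --> \oo] --> 0.
  move=> f0 fg g0; have : C * g k @[k --> \oo] --> C * 0 by apply: cvgMr.
  by rewrite mulr0; apply: squeeze_cvg0; near=> k; rewrite f0 fg.
split; apply: le0 => k; do ?exact: nrm_ge0.
  by have [_ + _ _] := CP _ (spacesB (nu k) nx); apply.
by have [+ _ _ _] := CP _ (spacesB (nu k) nx); apply.
Unshelve. all: by end_near. Qed.

Lemma weighted_complete n : ip_complete (weighted_space W n).
Proof.
move=> u nu uc; have [C C0 CP] := weight_bounds n.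
have [|x nx ux] := @spaces_complete n u nu.
  move=> r r0; have [|M uM] := uc (r / C); first by rewrite divr_gt0.
  exists M => i j Mi Mj; have [_ + _ _] := CP _ (spacesB (nu i) (nu j)).
  by move=> /le_lt_trans; apply; rewrite mulrC -ltr_pdivlMr//; apply: uM.
by exists x => //; apply/weighted_cvgE.
Qed.

(** The image of [X_n] is dense: a vector [z] of [X_n] orthogonal to it satisfies [<W z, z> = 0], so
    its weighted norm is zero. The lower bound on the weight makes preimages of a convergent
    sequence Cauchy, so the image is everything. *)
Lemma weight_surj n y : 'X_n y -> exists2 x, 'X_n x & w x = y.
Proof.
move=> ny; have [C C0 CP] := weight_bounds n.
have sA : is_subspace [set w x | x in 'X_n].
  split=> [|a _ _ [x nx <-] [z nz <-]].
    exists 0; first exact: spaces0.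
    have [Dx Dx'] := (spaces_dom (spaces0 n), spaces_dom (spaces0 n)).
    by have [_] := weightB Dx Dx'; rewrite !subrr.
  exists (a *: x + z); first exact: spaces_lin.
  by have [_] := weight_lin a (spaces_dom nx) (spaces_dom nz).
have AE : [set w x | x in 'X_n] `<=` sub_space ip 'X_n.
  by move=> _ [x nx <-]; apply: spaces_invariant.
have /ip_denseP[_ /(_ y ny)[u uA uy]] :
    ip_dense (sub_space ip 'X_n) [set w x | x in 'X_n].
  apply: (orth0_dense (E := spaces_ph n) (@spaces_complete n) sA AE) => z nz wz.
  apply: (nrm_eq0 (E := weighted_ph n) nz); rewrite /nrm /rform /=.
  rewrite /weighted_form -weight_symmetric; [|exact: spaces_dom nz..].
  by have /= -> := wz _ (imageP w nz); rewrite sqrtr0.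
have ex k : exists x, 'X_n x /\ w x = u k by have [x nx <-] := uA k; exists x.
have [v vP] := choice ex.
have nv k : 'X_n (v k) by case: (vP k).
have nu k : 'X_n (u k) by apply: AE; apply: uA.
have [|x nx vx] := @spaces_complete n v nv.
  move=> r r0; have uc := ip_cvg_cauchy (E := spaces_ph n) nu ny uy.
  have [|M uM] := uc (r / C); first by rewrite divr_gt0.
  exists M => i j Mi Mj; have [_ _ _] := CP _ (spacesB (nv i) (nv j)).
  have [_ ->] := weightB (spaces_dom (nv i)) (spaces_dom (nv j)).
  move=> /le_lt_trans; apply; rewrite mulrC -ltr_pdivlMr//.
  by have [[_ ->] [_ ->]] := (vP i, vP j); apply: uM.
exists x => //; apply: (ip_cvg_unique (E := spaces_ph n) nu (spaces_invariant nx) ny _ uy).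
have : C * N (v k - x) @[k --> \oo] --> C * 0 by apply: cvgMr.
rewrite mulr0; apply: squeeze_cvg0; near=> k; rewrite nrm_ge0/=.
have [_ _ + _] := CP _ (spacesB (nv k) nx).
by have [_ ->] := weightB (spaces_dom (nv k)) (spaces_dom nx); have [_ ->] := vP k.
Unshelve. all: by end_near. Qed.

(** * Density of the union and convergence of the projections *)

Lemma union_dense : ip_dense (whole_space ip) (\bigcup_n 'X_n).
Proof.
have [_ [_ dD] _ _ _] := weight_ess_self_adjoint W.
split=> // x _ e e0; have [a [_ [[_ /= aU] _]] xa] := dD x I e e0.
by exists a.
Qed.

Lemma proj_best n x u : 'X_n u -> N (x - P n x) <= N (x - u).
Proof.
move=> nu; have nPu := spacesB (proj_in n x) nu.
have -> : x - u = (x - P n x) + (P n x - u) by rewrite addrA subrK.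
move: (proj_orth x nPu); move: (x - P n x) (P n x - u) => a b ab.
rewrite -ler_sqr ?nnegrE ?nrm_ge0// !nrm_sq//.
rewrite (rformDl (E := whole_ph ip))// !(rformDr (E := whole_ph ip))//.
rewrite (rformC (E := whole_ph ip) (x := b))//.
have -> : rform (whole_space ip) a b = 0 by rewrite /rform /= ab.
by rewrite addr0 add0r lerDl rform_ge0.
Qed.

(** Some [u] in the union is close to [x]; since the spaces increase, every later projection of [x]
    is at least as close. *)
Lemma proj_cvg x : ip_cvg (whole_space ip) (fun n => P n x) x.
Proof.
have [_ dU] := union_dense; apply/ip_cvgP => r r0.
have [|u [n _ nu]] := dU x I (r ^+ 2)%:C; first by rewrite ltcR exprn_gt0.
rewrite sqdist_lt// => xu; exists n => m nm.
rewrite nrm_distC//; apply: le_lt_trans xu; apply: proj_best.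
exact: spaces_increasing nm _ nu.
Qed.

End Weight.

(** * The operators H_n and H_n W *)

Section LinearOperators.
Context {R : realType} {V : lmodType R[i]}.
Implicit Types (E : prehilbert V) (A : operator V) (x y z : V).

Definition endo (E : ipspace V) A := forall x, dom A x -> E x /\ E (A x).

Lemma linear_op_graph E A : linear_op A -> endo E A ->
  linear_graph E (graph A).
Proof.
move=> [[A0 Alin] Aapp] EA; split.
- by move=> [x y] [/= Ax ->]; apply: EA.
- split=> //=; have := Aapp (- 1) 0 0 A0 A0.
  by rewrite !scaleN1r oppr0 add0r addNr.
- move=> a x y x' y' [/= Ax ->] [/= Ax' ->].
  by split=> /=; [apply: Alin|rewrite Aapp].
- by move=> x y z [/= _ ->] [_ /= ->].
Qed.

Lemma graph_range_1subE A : graph_range_1sub (graph A) = range_1sub A.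
Proof.
apply/seteqP; split=> [_ [[x y] [/= Ax ->] <-]|_ [x Ax <-]]; first by exists x.
by exists (x, A x).
Qed.

Lemma op_closure_max_dissipative E A : linear_op A -> endo E A ->
  ip_dense E (dom A) -> dissipative E (graph A) ->
  ip_dense E (range_1sub A) -> closure_max_dissipative E (graph A).
Proof.
move=> lA EA dA diss dR; apply: dissipative_closure_max => //.
- exact: linear_op_graph.
- apply: ip_dense_sub dA _ _ => [x Ax|x [_ [/= Ax _]]]; first by exists (A x).
  by case: (EA x Ax).
- by rewrite graph_range_1subE.
Qed.

(** This is where completeness turns the absence of nonzero orthogonal vectors into density, the
    range being a subspace. *)
Lemma op_range_dense E A : ip_complete E -> linear_op A -> endo E A ->
  (forall z, E z -> (forall x, dom A x -> form E (x - A x) z = 0) -> z = 0) ->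
  ip_dense E (range_1sub A).
Proof.
move=> cE lA EA A0; apply: orth0_dense => //.
- case: (linear_op_graph lA EA) => _ [/= D0 D00] Glin _.
  split=> [|a _ _ [x Ax <-] [y Ay <-]].
    by exists 0 => //; rewrite -D00 subr0.
  have [/= Axy e] := Glin a x (A x) y (A y) (conj Ax erefl) (conj Ay erefl).
  by exists (a *: x + y) => //; rewrite -e opprD addrACA scalerBr.
- by move=> _ [x Ax <-]; case: (EA x Ax) => Ex EAx; apply: phB.
- by move=> z Ez zA; apply: A0 => // x Ax; apply: zA; exists x.
Qed.

Lemma closure_max_dissipative_sub E G : linear_graph E G ->
  closure_max_dissipative E G -> dissipative E G.
Proof.
move=> [GE _ _ _] [_ [_ dG _]] x y xy.
by apply: dG; apply: graph_closure_sub.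
Qed.

Lemma closure_max_dissipative_range E A : ip_complete E -> linear_op A ->
  endo E A -> closure_max_dissipative E (graph A) ->
  dissipative E (graph A) /\ ip_dense E (range_1sub A).
Proof.
move=> cE lA EA mA; have lG := linear_op_graph lA EA; split.
  exact: closure_max_dissipative_sub mA.
apply: op_range_dense => // z Ez z0; apply: (max_dissipative_orth0 lG mA Ez).
by move=> x _ [/= Ax ->]; apply: z0.
Qed.

End LinearOperators.

Section WeightedOperator.
Context {R : realType} {X : completeNormedModType R[i]}.
Context (ip : {dot X for Num.conj}) (ip_norm : forall x : X, `|x| ^+ 2 = ip x x).
Context (W : lf_weight ip) (H : operator X).
Context (H_linear : linear_op H) (H_dense : dense (dom H : set X)).
Context (H_invariant : forall n x, dom H x -> spaces W n x -> spaces W n (H x)).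
Context (H_proj : forall n x, dom H x ->
  dom H (orth_proj ip (spaces W n) x) /\
  H (orth_proj ip (spaces W n) x) = orth_proj ip (spaces W n) (H x)).
Implicit Types (x y z : X) (n : nat).

Local Notation w := (weight W).
Local Notation "'X_ n" := (spaces W n) (at level 8, n at level 2, format "''X_' n").
Local Notation P n := (orth_proj ip 'X_n).
Local Notation N := (nrm (whole_space ip)).
Local Notation Hn n := (part H 'X_n).
Local Notation Kn n := (weighted_part W H n).

Lemma part_linear n : linear_op (Hn n).
Proof.
case: H_linear => -[D0 Dlin] Happ; split; last by move=> a x y [Dx _] [Dy _]; apply: Happ.
split=> [|a x y [Dx nx] [Dy ny]]; first by split => //; apply: spaces0.
by split; [apply: Dlin|apply: spaces_lin].
Qed.

Lemma part_endo n : endo (sub_space ip 'X_n) (Hn n).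
Proof. by move=> x [Dx nx]; split => //; apply: H_invariant. Qed.

Lemma weighted_part_linear n : linear_op (Kn n).
Proof.
have [[Dom0 Domlin] Happ] := part_linear n.
have wlin a x y (nx : 'X_n x) (ny : 'X_n y) := weight_lin a (spaces_dom nx) (spaces_dom ny).
split.
  split=> [|a x y [nx Dx] [ny Dy]].
    split; first exact: spaces0.
    have [_] := weightB (spaces_dom (spaces0 W n)) (spaces_dom (spaces0 W n)).
    by rewrite !subrr => ->.
  split; first exact: spaces_lin.
  by have [_ ->] := wlin a x y nx ny; apply: Domlin.
move=> a x y [nx Dx] [ny Dy] /=; have [_ ->] := wlin a x y nx ny.
exact: Happ.
Qed.

Lemma weighted_part_endo n : endo (weighted_space W n) (Kn n).
Proof. by move=> x [nx [Dx nwx]]; split=> //; apply: H_invariant. Qed.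

Lemma part_dense n : ip_dense (sub_space ip 'X_n) (dom (Hn n)).
Proof.
have [_ dH] := dense_ip_dense ip_norm H_dense.
split=> [x []//|x nx e /gt0_sqC[r r0 ->]].
have [|u Du] := dH x I ((r / 2) ^+ 2)%:C; first by rewrite ltcR exprn_gt0// divr_gt0.
rewrite sqdist_lt ?divr_gt0// => xu; have [DPu _] := H_proj n Du.
have nPu := proj_in ip_norm W n u.
exists (P n u) => //; rewrite (sqdist_lt (E := spaces_ph W n))//.
(* As [P_n u] is the point of [X_n] nearest to [u], it is within [r / 2] of [u], just as [x] is. *)
apply: le_lt_trans (ler_nrmB (E := whole_ph ip) (y := u) _ _ _) _ => //.
have := proj_best ip_norm u nx; rewrite (nrm_distC (E := whole_ph ip) (x := u) (y := x))//.
move=> h; move: xu h; lra.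
Qed.

(** The domain is the preimage of [D(H_n)] under the weight, whose inverse on [X_n] is bounded;
    density is pulled back along it. *)
Lemma weighted_part_dense n : ip_dense (weighted_space W n) (dom (Kn n)).
Proof.
apply/ip_denseP; split=> [x []//|x nx].
have nwx := spaces_invariant nx.
have /ip_denseP[_ /(_ (w x) nwx)[u uD ux]] := part_dense n.
have ex k : exists v, 'X_n v /\ w v = u k.
  by have [_ /(weight_surj ip_norm)[v nv <-]] := uD k; exists v.
have [v vP] := choice ex.
have nv k : 'X_n (v k) by case: (vP k).
exists v => [k|]; first by have [_ e] := vP k; split=> //=; rewrite e; apply: uD.
apply/(weighted_cvgE ip_norm) => //; have [C C0 CP] := weight_bounds ip_norm W n.
have : C * N (u k - w x) @[k --> \oo] --> C * 0 by apply: cvgMr.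
rewrite mulr0; apply: squeeze_cvg0; near=> k; rewrite nrm_ge0/=.
have [_ _ _] := CP _ (spacesB (nv k) nx).
by have [_ ->] := weightB (spaces_dom (nv k)) (spaces_dom nx); have [_ ->] := vP k.
Unshelve. all: by end_near. Qed.

(** * Transfer between [H_n] and [H_n W], and between [H_n] and [H] *)

Lemma part_graph n x : dom H x -> 'X_n x -> graph (Hn n) (x, H x).
Proof. by []. Qed.

Lemma weighted_part_graph n x : 'X_n x -> dom H (w x) ->
  graph (Kn n) (x, H (w x)).
Proof. by move=> nx Dx; split=> //; split=> //; split=> //; apply: spaces_invariant. Qed.

Lemma weighted_part_dissipative n : dissipative (sub_space ip 'X_n) (graph (Hn n)) ->
  ip_dense (sub_space ip 'X_n) (range_1sub (Hn n)) ->
  dissipative (weighted_space W n) (graph (Kn n)) /\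
  ip_dense (weighted_space W n) (range_1sub (Kn n)).
Proof.
move=> dH rH; split.
  move=> x _ [[/= nx [Dx nwx]] ->].
  exact: (dH (w x) (H (w x)) (part_graph Dx nwx)).
apply: (op_range_dense (E := weighted_ph W n) (@weighted_complete _ _ _ ip_norm W n)
          (weighted_part_linear n) (@weighted_part_endo n)) => z nz zK.
apply: (rform_eq0 (E := weighted_ph W n) nz).
have nwz := spaces_invariant nz.
have [GE _ _ _] := linear_op_graph (E := spaces_ph W n) (part_linear n) (@part_endo n).
rewrite -graph_range_1subE in rH.
(* For [u = W x], orthogonality reads [<H u, W z> = <x, W z> = <u, z>]: the pair [(W z, z)] is in
   the adjoint of [H_n]. *)
apply: (adjoint_dissipative (E := spaces_ph W n) GE dH rH nz nwz) => u _ [[/= Du nu] ->].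
have [x nx xu] := weight_surj ip_norm nu.
have Dx : dom H (w x) by rewrite xu.
have := zK x (weighted_part_graph nx Dx).1; rewrite /rform /= /weighted_form dotBl.
move=> /eqP; rewrite subr_eq0 -xu => /eqP <-; congr complex.Re.
by rewrite weight_symmetric//; apply: (@spaces_dom _ _ _ W n).
Qed.

Lemma part_dissipative n : dissipative (weighted_space W n) (graph (Kn n)) ->
  ip_dense (weighted_space W n) (range_1sub (Kn n)) ->
  dissipative (sub_space ip 'X_n) (graph (Hn n)) /\
  ip_dense (sub_space ip 'X_n) (range_1sub (Hn n)).
Proof.
move=> dK rK; split.
  move=> u _ [[/= Du nu] ->]; have [x nx xu] := weight_surj ip_norm nu.
  rewrite -xu in Du *; exact: (dK x (H (w x)) (weighted_part_graph nx Du)).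
apply: (op_range_dense (E := spaces_ph W n) (@spaces_complete _ _ _ ip_norm W n)
          (part_linear n) (@part_endo n)) => z nz zH.
apply: (rform_eq0 (E := spaces_ph W n) nz).
have [v nv vz] := weight_surj ip_norm nz.
have [GE _ _ _] := linear_op_graph (E := weighted_ph W n) (weighted_part_linear n)
  (@weighted_part_endo n).
rewrite -graph_range_1subE in rK.
(* With [z = W v], the pair [(v, z)] is in the weighted adjoint of [H_n W], and
   [<z, v>_W = <z, z>]. *)
have := adjoint_dissipative (E := weighted_ph W n) GE dK rK nz nv.
rewrite /rform /= /weighted_form vz; apply=> x _ [[/= nx [Dx nwx]] ->].
have := zH (w x) (conj Dx nwx); rewrite /= dotBl.
move=> /eqP; rewrite subr_eq0 => /eqP <-; congr complex.Re.
by rewrite weight_symmetric//; apply: (@spaces_dom _ _ _ W n).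
Qed.

(** For [z] in [X_n], [<x - H x, z> = <P_n x - H P_n x, z>]. Hence a vector of [X_n] orthogonal to
    the range of [1 - H_n] is orthogonal to that of [1 - H], and maximality in [X] makes it zero. *)
Lemma closure_max_part n : closure_max_dissipative (whole_space ip) (graph H) ->
  dissipative (sub_space ip 'X_n) (graph (Hn n)) /\
  ip_dense (sub_space ip 'X_n) (range_1sub (Hn n)).
Proof.
move=> mH.
have lG : linear_graph (whole_space ip) (graph H).
  by apply: (linear_op_graph (E := whole_ph ip)).
have dH := closure_max_dissipative_sub (E := whole_ph ip) lG mH; split.
  by move=> x _ [[/= Dx nx] ->]; apply: (dH x (H x)).
apply: (op_range_dense (E := spaces_ph W n) (@spaces_complete _ _ _ ip_norm W n)
          (part_linear n) (@part_endo n)) => z nz zH.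
apply: (max_dissipative_orth0 (E := whole_ph ip) lG mH I) => x _ [/= Dx ->].
have [DPx HPx] := H_proj n Dx.
have := zH (P n x) (conj DPx (proj_in ip_norm W n x)).
by rewrite /= HPx !dotBl !(dot_projl ip_norm).
Qed.

Lemma part_closure_max :
  (forall n, dissipative (sub_space ip 'X_n) (graph (Hn n)) /\
    ip_dense (sub_space ip 'X_n) (range_1sub (Hn n))) ->
  closure_max_dissipative (whole_space ip) (graph H).
Proof.
move=> dH; apply: (op_closure_max_dissipative (E := whole_ph ip)) => //.
- exact: dense_ip_dense.
- apply/dissipativeP => x _ [/= Dx ->].
  apply: (ip_cvg_rform_le0 (E := whole_ph ip) (u := fun n => P n (H x))
    (v := fun n => P n x)) => //; do ?exact: proj_cvg.
  move=> n; have [DPx <-] := H_proj n Dx.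
  have [/dissipativeP dHn _] := dH n; apply: dHn.
  by apply: part_graph => //; apply: proj_in.
- apply: (ip_dense_trans (E := whole_ph ip) (union_dense W)) => // b r [n _ nb] r0.
  have [_ [RE dR]] := dH n.
  have [|a Ra] := dR b nb (r ^+ 2)%:C; first by rewrite ltcR exprn_gt0.
  rewrite (sqdist_lt (E := spaces_ph W n))//; last exact: RE.
  by move=> ba; exists a => //; case: Ra => x [Dx _] <-; exists x.
Qed.

End WeightedOperator.

(** * The operator H W in the completion *)

Section WeightedCompletion.
Context {R : realType} {X : completeNormedModType R[i]}.
Context (ip : {dot X for Num.conj}) (ip_norm : forall x : X, `|x| ^+ 2 = ip x x).
Context (W : lf_weight ip) (H : operator X).
Context (H_linear : linear_op H) (H_dense : dense (dom H : set X)).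
Context (H_invariant : forall n x, dom H x -> spaces W n x -> spaces W n (H x)).
Context (H_proj : forall n x, dom H x ->
  dom H (orth_proj ip (spaces W n) x) /\
  H (orth_proj ip (spaces W n) x) = orth_proj ip (spaces W n) (H x)).

Local Notation w := (weight W).
Local Notation "'X_ n" := (spaces W n) (at level 8, n at level 2, format "''X_' n").
Local Notation P n := (orth_proj ip 'X_n).
Local Notation Kn n := (weighted_part W H n).
Local Notation U := (weighted_union W).
Local Notation C := (completion_space U).
Local Notation Pseq x := (fun k => P k x).
Implicit Types (x y z : X) (p q : completion U) (n : nat).

Lemma represents_unique (u : nat -> X) p q :
  represents (E := U) u p -> represents (E := U) u q -> p = q.
Proof.
by move=> [c cu <-] [d du <-]; congr completion_class; apply: val_inj; rewrite /= cu.
Qed.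

Lemma represents_lin (a : R[i]) (u v : nat -> X) p q :
  represents (E := U) u p -> represents (E := U) v q ->
  represents (E := U) (fun k => a *: u k + v k) (a *: p + q).
Proof.
move=> [c <- <-] [d <- <-]; exists (a *: c + d) => //.
by rewrite completion_classD completion_classZ.
Qed.

Lemma representsB (u v : nat -> X) p q :
  represents (E := U) u p -> represents (E := U) v q ->
  represents (E := U) (fun k => u k - v k) (p - q).
Proof.
move=> up vq; have := represents_lin (- 1) vq up; rewrite scaleN1r addrC.
by congr represents; apply/funext => k; rewrite scaleN1r addrC.
Qed.

Lemma representsZ (a : R[i]) (u : nat -> X) p :
  represents (E := U) u p -> represents (E := U) (fun k => a *: u k) (a *: p).
Proof. by move=> [c <- <-]; exists (a *: c); rewrite ?completion_classZ. Qed.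

Lemma represents_in (u : nat -> X) p k : represents (E := U) u p -> U (u k).
Proof. by move=> [c <- _]; apply: cseqE. Qed.

Lemma represents_rform (u v : nat -> X) p q :
  represents (E := U) u p -> represents (E := U) v q ->
  rform U (u k) (v k) @[k --> \oo] --> rform C p q.
Proof. by move=> [c <- <-] [d <- <-]; apply: cvg_rform_completion. Qed.

Lemma cvgn_near_cst (f : nat -> R) (a l : R) n :
  (forall k, (n <= k)%N -> f k = a) -> f k @[k --> \oo] --> l -> l = a.
Proof.
move=> fa fl; apply: (cvgn_unique fl); apply: cvg_near_cst.
by exists n => // k /= /fa.
Qed.

Lemma proj_id_le n k x : 'X_n x -> (n <= k)%N -> P k x = x.
Proof. by move=> nx nk; apply: (proj_id ip_norm); apply: spaces_increasing nk _ nx. Qed.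

(** The sequence of projections equals [x] from index [n] on. *)
Lemma represents_proj n x : 'X_n x -> exists p, represents (E := U) (Pseq x) p.
Proof.
move=> nx; have cP : Pseq x \in cauchy_pred U.
  apply/asboolP; split=> [k|e e0]; first by exists k => //; apply: proj_in.
  exists n => i j ni nj; rewrite !(proj_id_le nx)// /sqdist subrr.
  by rewrite form0l//; apply: ph0.
by exists (completion_class (CauchySeq cP)), (CauchySeq cP).
Qed.

Lemma represents_proj_rform n x y p q : 'X_n x -> 'X_n y ->
  represents (E := U) (Pseq x) p -> represents (E := U) (Pseq y) q ->
  rform C p q = rform U x y.
Proof.
move=> nx ny xp yq; apply: (@cvgn_near_cst _ _ _ n) (represents_rform xp yq).
by move=> k nk; rewrite !(proj_id_le _ nk).
Qed.

(** For [d = x - y] the projections represent 0. Pairing them with [P_m d] gives, from index [m] on,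
    the constant [|P_m d|_W^2], which is therefore 0; so every [P_m d] vanishes, and so does their
    limit [d]. *)
Lemma represents_inj x y p : dom w x -> dom w y ->
  represents (E := U) (Pseq x) p -> represents (E := U) (Pseq y) p -> x = y.
Proof.
move=> Dx Dy xp yp; apply/eqP; rewrite -subr_eq0; apply/eqP.
set d := x - y.
have d0 : represents (E := U) (Pseq d) 0.
  have := representsB xp yp; rewrite subrr; congr represents.
  by apply/funext => k; rewrite (projB ip_norm).
have Pd0 m : P m d = 0.
  have mP := proj_in ip_norm W m d; have mwP := spaces_invariant mP.
  have [v vP] := represents_proj mP.
  apply: (rform_eq0 (E := weighted_ph W m) mP).
  suff -> : rform (weighted_ph W m) (P m d) (P m d) = 0 by [].
  have <- : rform C 0 v = 0 by apply: (rform0l (E := completion_ph U)).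
  apply/esym; apply: (@cvgn_near_cst _ _ _ m) (represents_rform d0 vP) => k mk.
  rewrite (proj_id_le mP mk) /rform /= /weighted_form.
  by rewrite !(dot_projl ip_norm)//; apply: spaces_increasing mk _ mwP.
apply: (ip_cvg_unique (E := whole_ph ip) (u := Pseq d)) => //.
  exact: proj_cvg.
have -> : Pseq d = fun=> 0 by apply/funext.
exact: (ip_cvg_cst (E := whole_ph ip)).
Qed.

Lemma weighted_graph_proj n x : dom w x -> dom H (w x) ->
  graph (Kn n) (P n x, P n (H (w x))).
Proof.
move=> Dx Dwx; have [DP HP] := H_proj n Dwx.
rewrite -HP (proj_weight ip_norm)// in DP *.
by apply: (weighted_part_graph (proj_in ip_norm W n x)).
Qed.

Lemma weighted_graph_linear : linear_graph C (weighted_graph W H).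
Proof.
have [[D0 Dlin] Happ] := H_linear.
split=> //.
- have [D00 w0] := weightB (spaces_dom (spaces0 W 0)) (spaces_dom (spaces0 W 0)).
  rewrite !subrr in D00 w0.
  have H0 : H 0 = 0.
    by have := Happ (- 1) 0 0 D0 D0; rewrite !scaleN1r oppr0 addr0 addNr.
  have r0 : represents (E := U) (Pseq 0) 0.
    have [p zp] := represents_proj (spaces0 W 0).
    have := representsB zp zp; rewrite subrr; congr represents.
    by apply/funext => k; rewrite subrr (proj_id ip_norm)//; apply: spaces0.
  by exists 0; rewrite w0 H0.
- move=> a p q p' q' [x [/= Dx xp Dwx xq]] [x' [/= Dx' xp' Dwx' xq']].
  have [Da wa] := weight_lin a Dx Dx'.
  exists (a *: x + x'); split=> //=.
  + have := represents_lin a xp xp'; congr represents.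
    by apply/funext => k; rewrite (proj_lin ip_norm).
  + by rewrite wa; apply: Dlin.
  + have := represents_lin a xq xq'; congr represents.
    by apply/funext => k; rewrite wa Happ// (proj_lin ip_norm).
- move=> p q q' [x [/= Dx xp Dwx xq]] [x' [/= Dx' xp' Dwx' xq']].
  rewrite -(represents_inj Dx Dx' xp xp') in xq'.
  exact: represents_unique xq xq'.
Qed.

Lemma weighted_graph_part n x : dom (Kn n) x -> exists p q,
  [/\ weighted_graph W H (p, q), represents (E := U) (Pseq x) p &
      represents (E := U) (Pseq (H (w x))) q].
Proof.
move=> [nx [Dwx nwx]].
have [p xp] := represents_proj nx.
have [q xq] := represents_proj (H_invariant Dwx nwx).
by exists p, q; split=> //; exists x; split=> //; apply: spaces_dom nx.
Qed.

(** A class is approximated by a far term of a representing sequence; that term lies in some [X_n],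
    where [A n] is dense. *)
Lemma completion_dense (A : nat -> set X) (B : set (completion U)) :
  (forall n, ip_dense (weighted_space W n) (A n)) ->
  (forall n x, A n x -> exists2 p, B p & represents (E := U) (Pseq x) p) ->
  ip_dense C B.
Proof.
move=> dA AB; split=> // p _ e /gt0_sqC[r r0 ->].
have [c cp] := completion_surj p; rewrite -cp.
have r30 : 0 < r / 3 by rewrite divr_gt0.
have [M cM] := cauchy_seq_ip_cauchy c r30.
have [n _ ncM] := cseqE c M.
have [AE dAn] := dA n.
have [|a Aa] := dAn (c M) ncM ((r / 3) ^+ 2)%:C; first by rewrite ltcR exprn_gt0.
have na := AE _ Aa; rewrite (sqdist_lt (E := weighted_ph W n))// => cMa.
have [q Bq [d da dq]] := AB n a Aa; exists q => //.
rewrite (sqdist_lt (E := completion_ph U))// -dq.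
have -> : completion_class c - completion_class d = completion_class (c - d).
  by rewrite -[in RHS]scaleN1r completion_classD completion_classZ scaleN1r.
(* Limits preserve only weak inequalities; the third [r / 3] restores strictness. *)
apply: (@le_lt_trans _ _ (r / 3 + r / 3)); last by lra.
apply: ler_cvg_to (@cvg_nrm_completion _ _ U (c - d)) (cvg_cst (r / 3 + r / 3)) _.
exists (maxn M n) => // k /=; rewrite geq_max => /andP[Mk nk].
have dk : d k = a by rewrite da (proj_id_le na nk).
rewrite [X in nrm _ X <= _](_ : _ = c k - a); last by rewrite -dk.
have Ua : U a by exists n.
apply: le_trans (ler_nrmB (cseqE c k) (cseqE c M) Ua) _.
by apply: lerD; apply: ltW => //; apply: cM.
Qed.

Lemma weighted_graph_closure_max :
  (forall n, dissipative (weighted_space W n) (graph (Kn n)) /\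
    ip_dense (weighted_space W n) (range_1sub (Kn n))) ->
  closure_max_dissipative C (weighted_graph W H).
Proof.
move=> dK; apply: (dissipative_closure_max (E := completion_ph U)).
- exact: weighted_graph_linear.
- apply/dissipativeP => p q [x [/= Dx xp Dwx xq]].
  apply: ler_cvg_to (represents_rform xq xp) (cvg_cst 0) _.
  exists 0%N => // n _ /=; have [/dissipativeP dKn _] := dK n.
  exact: (dKn _ _ (weighted_graph_proj n Dx Dwx)).
- apply: (completion_dense
    (weighted_part_dense ip_norm H_dense H_proj)) => n x /weighted_graph_part.
  by move=> [p [q [pq xp _]]]; exists p => //; exists q.
- apply: (completion_dense (fun n => (dK n).2)) => n _ [x Kx <-].
  have [p [q [pq xp xq]]] := weighted_graph_part Kx.
  exists (p - q); first by exists (p, q).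
  have := representsB xp xq; congr represents; apply/funext => k.
  by rewrite (projB ip_norm).
Qed.

(** If [z] in [X_n] is orthogonal to the range of [1 - H_n W], its class is orthogonal to the range
    of [1 - H W], since for [k >= n] pairing with [z] sees only the projections onto [X_n].
    Maximality makes the class zero, and it has the norm of [z]. *)
Lemma weighted_graph_part_max n :
  closure_max_dissipative C (weighted_graph W H) ->
  dissipative (weighted_space W n) (graph (Kn n)) /\
  ip_dense (weighted_space W n) (range_1sub (Kn n)).
Proof.
move=> mG; have lG := weighted_graph_linear.
have /dissipativeP dG := closure_max_dissipative_sub (E := completion_ph U) lG mG.
split.
  apply/dissipativeP => x _ [/= Kx ->].
  have [p [q [pq xp xq]]] := weighted_graph_part Kx.
  have [nx nHwx] := weighted_part_endo H_invariant Kx.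
  by have := dG _ _ pq; rewrite (represents_proj_rform nHwx nx xq xp).
apply: (op_range_dense (E := weighted_ph W n) (@weighted_complete _ _ _ ip_norm W n)
  (weighted_part_linear W H_linear n) (@weighted_part_endo _ _ _ _ _ H_invariant n)) => z nz zK.
have [r zr] := represents_proj nz.
suff r0 : r = 0.
  apply: (rform_eq0 (E := weighted_ph W n) nz).
  have <- : rform C r r = rform (weighted_ph W n) z z.
    exact: (represents_proj_rform nz nz zr zr).
  by rewrite r0 (rform0l (E := completion_ph U)).
apply: (max_dissipative_orth0 (E := completion_ph U) lG mG I).
move=> p q [x [/= Dx xp Dwx xq]].
apply/(@form_eq0P _ _ (completion_ph U)) => // a.
have apq := representsZ a (representsB xp xq).
apply: (@cvgn_near_cst _ _ _ n) (represents_rform apq zr) => k nk.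
have nwz := spaces_invariant nz; have kwz := spaces_increasing nk nwz.
have [[/= nPx DPx] HPx] := weighted_graph_proj n Dx Dwx.
have zPx := zK (P n x) (conj nPx DPx).
rewrite /= -HPx /weighted_form dotBl !(dot_projl ip_norm)// in zPx.
rewrite -[LHS]/(rform U (a *: (P k x - P k (H (w x)))) (P k z)).
rewrite /rform (proj_id_le nz nk) formZl; last 2 first.
- by apply: phB; [apply: represents_in xp|apply: represents_in xq].
- by exists n.
by rewrite /= /weighted_form dotBl !(dot_projl ip_norm)// zPx mulr0.
Qed.

End WeightedCompletion.

(** * The cycle of implications *)

Theorem theorem4p12 (R : realType) (X : completeNormedModType R[i])
    (ip : {dot X for Num.conj}) (ip_norm : forall x : X, `|x| ^+ 2 = ip x x)
    (W : lf_weight ip) (H : operator X)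
    (H_linear : linear_op H) (H_dense : dense (dom H : set X))
    (H_invariant : forall n x, dom H x -> spaces W n x -> spaces W n (H x))
    (H_proj : forall n x, dom H x ->
      dom H (orth_proj ip (spaces W n) x) /\
      H (orth_proj ip (spaces W n) x) = orth_proj ip (spaces W n) (H x)) :
  [<-> closure_max_dissipative (whole_space ip) (graph H);
       forall n, dissipative (sub_space ip (spaces W n))
                             (graph (part H (spaces W n))) /\
                 ip_dense (sub_space ip (spaces W n))
                          (range_1sub (part H (spaces W n)));
       forall n, closure_max_dissipative (sub_space ip (spaces W n))
                                         (graph (part H (spaces W n)));
       forall n, dissipative (weighted_space W n)
                             (graph (weighted_part W H n)) /\
                 ip_dense (weighted_space W n)
                          (range_1sub (weighted_part W H n));
       forall n, closure_max_dissipative (weighted_space W n)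
                                         (graph (weighted_part W H n));
       closure_max_dissipative (weighted_completion_space W)
                               (weighted_graph W H)].
Proof.
tfae.
- by move=> mH n; apply: closure_max_part.
- move=> dH n; have [dHn rHn] := dH n.
  apply: (op_closure_max_dissipative (E := spaces_ph W n)) => //.
  + exact: part_linear.
  + exact: part_endo.
  + exact: part_dense.
- move=> mH n; have [dHn rHn] := closure_max_dissipative_range
    (E := spaces_ph W n) (@spaces_complete _ _ _ ip_norm W n)
    (part_linear W H_linear n) (@part_endo _ _ _ _ _ H_invariant n) (mH n).
  exact: weighted_part_dissipative.
- move=> dK n; have [dKn rKn] := dK n.
  apply: (op_closure_max_dissipative (E := weighted_ph W n)) => //.
  + exact: weighted_part_linear.
  + exact: weighted_part_endo.
  + exact: weighted_part_dense.
- move=> mK; apply: weighted_graph_closure_max => // n.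
  exact: (closure_max_dissipative_range
    (E := weighted_ph W n) (@weighted_complete _ _ _ ip_norm W n)
    (weighted_part_linear W H_linear n)
    (@weighted_part_endo _ _ _ _ _ H_invariant n) (mK n)).
(* The cycle closes by descending from the completion to each [X_n], removing the weight there, and
   passing to the limit in [X]. *)
- move=> mG; apply: (part_closure_max ip_norm (W := W)) => // n.
  have [dK rK] := weighted_graph_part_max ip_norm H_linear H_invariant H_proj n mG.
  exact: part_dissipative.
Qed.
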